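(* Let $d\ge2$ and $\Phi=2U_1$. Let $\Sigma$ be an increasing and rotation invariant size functional, and let $a>0$ be such that $\Sigma^{-1}([a,\infty))\ne\emptyset$. Let $\vartheta$ be a deviation functional for $\Phi,\Sigma,a$, and let $f_a$ be a stability function for $\Phi,\Sigma,a,\vartheta$. If $\varepsilon\in(0,1]$ and $\kappa\in(0,1)$, then there is a constant $c_3>0$, depending on $\Sigma,a,\vartheta,d,\varepsilon,\kappa$, such that for every $\gamma_s\in(0,\infty)$ the Crofton cell $Z_0$ of the hypersphere tessellation derived from an isotropic Poisson point process $X$ on $\mathbb{S}^d$ with intensity $\gamma_s$ satisfies $$\mathbb{P}\left(\vartheta(Z_0)\ge\varepsilon\mid\Sigma(Z_0)\ge a\right)\le c_3\exp\left(-\kappa\,\gamma_s\,f_a(\varepsilon)\,\tau(\Phi,\Sigma,a)\right).$$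
   Context: $\mathbb{S}^d$ is the unit sphere in $\mathbb{R}^{d+1}$ ($d\ge2$), $\sigma_d^\circ$ its normalized (probability) spherical Lebesgue measure. $\overline{\mathcal{K}}^d_s$ is the set of spherically convex bodies, i.e. intersections of $\mathbb{S}^d$ with a closed convex cone in $\mathbb{R}^{d+1}$ that is not a linear subspace, with the spherical Hausdorff metric. $U_1(K)=\frac12\int_{\mathbb{S}^d}\mathbf 1\{x^\perp\cap K\ne\emptyset\}\,\sigma_d^\circ(dx)$. A size functional is a continuous map $\Sigma:\overline{\mathcal{K}}^d_s\to[0,\infty)$ with $\Sigma\not\equiv0$ and $\Sigma(\{e\})=0$ for all $e\in\mathbb{S}^d$; increasing refers to set inclusion. Convention: $\Sigma$ is extended to $\mathbb{S}^d$ by a value with $\Sigma(\mathbb{S}^d)\ge\Sigma(K)$ for all $K\in\overline{\mathcal{K}}^d_s$. $\Sigma^{-1}([a,\infty))=\{K\in\overline{\mathcal{K}}^d_s:\Sigma(K)\ge a\}$. $\tau(\Phi,\Sigma,a)=\min\{\Phi(K):K\in\overline{\mathcal{K}}^d_s,\Sigma(K)\ge a\}$ and $\mathcal{E}(\Phi,\Sigma,a)=\{K\in\overline{\mathcal{K}}^d_s:\Sigma(K)\ge a,\Phi(K)=\tau(\Phi,\Sigma,a)\}$. A deviation functional for $\Phi,\Sigma,a$ is a continuous map $\vartheta:\Sigma^{-1}([a,\infty))\to[0,\infty)$ with $\vartheta(K)=0$ iff $K\in\mathcal{E}(\Phi,\Sigma,a)$. A stability function for $\Phi,\Sigma,a,\vartheta$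 is an increasing function $f_a:[0,\infty)\to[0,1]$ with $f_a(0)=0$, $f_a(t)>0$ for $t>0$, and $\Phi(K)\ge(1+f_a(t))\tau(\Phi,\Sigma,a)$ for all $t\ge0$ and all $K\in\Sigma^{-1}([a,\infty))$ with $\vartheta(K)\ge t$ (such a function always exists). An isotropic Poisson point process $X$ with intensity $\gamma_s$ is a Poisson process on $\mathbb{S}^d$ with intensity measure $\gamma_s\sigma_d^\circ$. The associated hypersphere tessellation partitions $\mathbb{S}^d$ by the great hyperspheres $\mathbb{S}^d\cap x^\perp$, $x\in X$ (cells are closures of connected components of the complement of their union; if $X$ is empty the only cell is $\mathbb{S}^d$). Fix $\mathsf p\in\mathbb{S}^d$; the Crofton cell $Z_0$ is the almost surely unique cell containing $\mathsf p$ in its interior. Convention: the event $\{\vartheta(Z_0)\ge\varepsilon\}$ (given $\Sigma(Z_0)\ge a$) is understood to require $Z_0\in\overline{\mathcal{K}}^d_s$. *)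

(* Defs.v *)
From HB Require Import structures.
From mathcomp Require Import all_boot all_order all_algebra.
From mathcomp Require Import all_classical all_reals all_analysis.
From mathcomp Require Import measurable_realfun.
Set Implicit Arguments. Unset Strict Implicit. Unset Printing Implicit Defensive.
Import Order.TTheory GRing.Theory Num.Theory.
Import numFieldNormedType.Exports.
Local Open Scope classical_set_scope.
Local Open Scope ring_scope.

Lemma sigma_finite_product d1 d2 (T1 : measurableType d1)
    (T2 : measurableType d2) (R : realType)
    (m1 : {sigma_finite_measure set T1 -> \bar R})
    (m2 : {sigma_finite_measure set T2 -> \bar R}) :
  sigma_finite setT (m1 \x m2)%E.
Proof.
have /sigma_finiteP[F [TF ndF Foo]] := sigma_finiteT m1.
have /sigma_finiteP[G [TG ndG Goo]] := sigma_finiteT m2.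
exists (fun n => F n `*` G n).
  rewrite -setXTT TF TG predeqE => -[x y]; split; last first.
    by move=> [n _ []/= ? ?]; split; exists n.
  move=> [/= [n _ Fnx] [k _ Gky]]; exists (maxn n k) => //; split.
  - by move: x Fnx; exact/subsetPset/ndF/leq_maxl.
  - by move: y Gky; exact/subsetPset/ndG/leq_maxr.
move=> k; have [? ?] := Foo k; have [? ?] := Goo k.
split; first exact: measurableX.
by rewrite product_measure1E// lte_mul_pinfty// ge0_fin_numE.
Qed.

(* The n-fold product of [mu], as a measure on n-tuples. *)
Section tuple_power_measure.
Context d (T : measurableType d) (R : realType).
Variable mu : {sigma_finite_measure set T -> \bar R}.

Definition tuple_cons n (x : T * n.-tuple T) : n.+1.-tuple T :=
  [tuple of x.1 :: x.2].

Lemma measurable_tuple_cons n : measurable_fun setT (@tuple_cons n).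
Proof. by apply: (measurable_cons (f := fst) (g := snd)). Qed.

HB.instance Definition _ n := isMeasurableFun.Build _ _ _ _ (@tuple_cons n)
  (@measurable_tuple_cons n).

Section step.
Variables (n : nat) (m : {sigma_finite_measure set (n.-tuple T) -> \bar R}).

Definition cons_measure : set (n.+1.-tuple T) -> \bar R :=
  pushforward (mu \x m)%E (@tuple_cons n).

Let cons_measure0 : cons_measure set0 = 0%E.
Proof. by rewrite /cons_measure measure0. Qed.

Let cons_measure_ge0 A : (0 <= cons_measure A)%E.
Proof. exact: measure_ge0. Qed.

Let cons_measure_sigma_additive : semi_sigma_additive cons_measure.
Proof. exact: measure_semi_sigma_additive. Qed.

HB.instance Definition _ := isMeasure.Build _ _ _ cons_measure
  cons_measure0 cons_measure_ge0 cons_measure_sigma_additive.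

Let cons_measure_sigma_finite : sigma_finite setT cons_measure.
Proof.
have [F FT Ff] := sigma_finite_product mu m.
pose un (t : n.+1.-tuple T) : T * n.-tuple T := (thead t, [tuple of behead t]).
have mun : measurable_fun setT un.
  apply/measurable_fun_pairP; split; first exact: measurable_tnth.
  exact: measurable_behead.
exists (fun i => un @^-1` F i).
  by rewrite -preimage_bigcup -FT preimage_setT.
move=> i; have [mFi Fi] := Ff i; split; first by rewrite -[X in measurable X]setTI; exact: mun.
rewrite /cons_measure /pushforward -comp_preimage (_ : un \o _ = id)//.
by apply/funext => -[x t]; congr pair; rewrite /=; apply/val_inj.
Qed.

HB.instance Definition _ := Measure_isSigmaFinite.Build _ _ _ cons_measure
  cons_measure_sigma_finite.
End step.

Fixpoint tuple_measure n : {sigma_finite_measure set (n.-tuple T) -> \bar R} :=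
  match n with
  | 0 => dirac ([tuple] : 0.-tuple T)
  | k.+1 => cons_measure (tuple_measure k)
  end.

End tuple_power_measure.

Notation borel_rV R n := (g_sigma_algebraType (@open 'rV[R]_n)).

Section borel_measurability.
Context (R : realType) (n : nat).

Lemma measurable_fun_rV d (T : measurableType d) (f : T -> 'rV[R]_n) :
  (forall i, measurable_fun setT (fun t => f t ord0 i)) ->
  measurable_fun setT (f : T -> borel_rV R n).
Proof.
move=> mf; apply: (@measurability _ _ T (borel_rV R n) setT f open) => // _ [U oU <-].
rewrite setTI.
pose box (c : {ffun 'I_n -> rat * rat}) : set 'rV[R]_n :=
  [set x | forall i, ratr (c i).1 < x ord0 i < ratr (c i).2].
rewrite (_ : U = \bigcup_c (if `[< box c `<=` U >] then box c else set0)).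
  rewrite preimage_bigcup; apply: countable_bigcupT_measurable => // c.
  case: ifPn => _; last by rewrite preimage_set0.
  rewrite (_ : _ @^-1` _ = \bigcap_(i in [set: 'I_n])
     ((fun t => f t ord0 i) @^-1` `]ratr (c i).1, ratr (c i).2[)).
    apply: fin_bigcap_measurable => // i _.
    by rewrite -[X in measurable X]setTI; exact: mf.
  apply/seteqP; split=> t /= H i; first by move=> _; rewrite /= in_itv; exact: H.
  by have := H i I; rewrite /= in_itv.
apply/seteqP; split=> [x Ux|x [c _]]; last first.
  by case: ifPn => // /asboolP; exact.
have /nbhs_ballP[e /= e0 xeU] : nbhs x U by exact: open_nbhs_nbhs.
have /choice[q qP] : forall i, exists q : rat * rat,
    [/\ x ord0 i - e < ratr q.1 < x ord0 i & x ord0 i < ratr q.2 < x ord0 i + e].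
  move=> i.
  have /rat_in_itvoo[a ha] : x ord0 i - e < x ord0 i by rewrite ltrBlDr ltrDl.
  have /rat_in_itvoo[b hb] : x ord0 i < x ord0 i + e by rewrite ltrDl.
  by exists (a, b); move: ha hb; rewrite !in_itv.
pose c := [ffun i => q i].
have cU : box c `<=` U.
  move=> y cy; apply: xeU; split => [|i j]; first exact: e0; rewrite (ord1 i).
  have := cy j; rewrite ffunE => /andP[y1 y2].
  have [/andP[q1 q2] /andP[q3 q4]] := qP j.
  rewrite /ball /= ltr_distlC; apply/andP; split.
    exact: lt_trans q1 y1.
  exact: lt_trans y2 q4.
exists c => //; case: ifPn => [_ i|/asboolP//].
by rewrite ffunE; have [/andP[_ ->] /andP[-> _]] := qP i.
Qed.

Lemma measurable_coord i :
  measurable_fun setT (fun x : borel_rV R n => (x : 'rV[R]_n) ord0 i).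
Proof.
apply: (measurability _ (RGenOpens.measurableE R)).
move=> _ [_ [a [b ->] <-]]; rewrite setTI; apply: sub_sigma_algebra.
apply: open_comp; last exact: interval_open.
by move=> x _; exact: coord_continuous.
Qed.

End borel_measurability.

Section lebesgue_rV.
Context (R : realType) (n : nat).

Definition tuple_rV (t : n.-tuple (measurableTypeR R)) : borel_rV R n :=
  \row_i tnth t i.

Lemma measurable_tuple_rV : measurable_fun setT tuple_rV.
Proof.
apply: measurable_fun_rV => i.
rewrite [X in measurable_fun _ X](_ : _ = (@tnth n (measurableTypeR R))^~ i).
  exact: measurable_tnth.
by apply/funext => t; rewrite mxE.
Qed.

HB.instance Definition _ := isMeasurableFun.Build _ _ _ _ tuple_rV
  measurable_tuple_rV.

Definition lebesgue_rV : set (borel_rV R n) -> \bar R :=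
  pushforward (tuple_measure (@lebesgue_measure R) n) tuple_rV.

Let lebesgue_rV0 : lebesgue_rV set0 = 0%E.
Proof. by rewrite /lebesgue_rV measure0. Qed.

Let lebesgue_rV_ge0 A : (0 <= lebesgue_rV A)%E.
Proof. exact: measure_ge0. Qed.

Let lebesgue_rV_sigma_additive : semi_sigma_additive lebesgue_rV.
Proof. exact: measure_semi_sigma_additive. Qed.

HB.instance Definition _ := isMeasure.Build _ _ _ lebesgue_rV
  lebesgue_rV0 lebesgue_rV_ge0 lebesgue_rV_sigma_additive.

End lebesgue_rV.

Section sphere.
Context (R : realType).

(* The topology of ['rV[R]_n] comes from the sup norm; angles and lengths are
   those of the Euclidean scalar product. *)
Definition dotv n (x y : 'rV[R]_n) : R := \sum_(i < n) x ord0 i * y ord0 i.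
Definition enorm n (x : 'rV[R]_n) : R := Num.sqrt (dotv x x).

Variable d : nat.

Definition sphere : set 'rV[R]_d.+1 := [set x | enorm x = 1].

Definition geodist (x y : 'rV[R]_d.+1) : R := acos (dotv x y).

Definition hausdorff (K L : set 'rV[R]_d.+1) : R :=
  Num.max (sup [set inf [set geodist x y | y in L] | x in K])
          (sup [set inf [set geodist x y | x in K] | y in L]).

Definition great_hypersphere (x : 'rV[R]_d.+1) : set 'rV[R]_d.+1 :=
  [set y | sphere y /\ dotv x y = 0].

Definition punctured_ball : set (borel_rV R d.+1) :=
  [set x | 0 < enorm x <= 1].

Definition normalize (x : borel_rV R d.+1) : borel_rV R d.+1 :=
  (enorm x)^-1 *: (x : 'rV[R]_d.+1).

Let measurable_enorm :
  measurable_fun setT (fun x : borel_rV R d.+1 => @enorm d.+1 x).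
Proof.
apply: (measurableT_comp (f := @Num.sqrt R)).
  by apply: continuous_measurable_fun => x; exact: sqrt_continuous.
by apply: measurable_sum => i; apply: measurable_funM; exact: measurable_coord.
Qed.

Let measurable_inv : measurable_fun setT (@GRing.inv R).
Proof.
rewrite -(setUv [set 0 : R]).
apply/measurable_funU => //; first exact: measurableC.
split; first exact: measurable_fun_set1.
apply: open_continuous_measurable_fun.
  by apply: closed_openC; exact: closed_eq.
by move=> x; rewrite inE /= => /eqP x0; exact: inv_continuous.
Qed.

Lemma measurable_punctured_ball : measurable punctured_ball.
Proof.
rewrite (_ : punctured_ball =
    setT `&` (fun x : borel_rV R d.+1 => @enorm d.+1 x) @^-1` `]0, 1]).
  exact: measurable_enorm.
by rewrite setTI; apply/seteqP; split => x; rewrite /= in_itv.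
Qed.

Lemma measurable_normalize : measurable_fun setT normalize.
Proof.
apply: measurable_fun_rV => i.
rewrite [X in measurable_fun _ X](_ : _ =
    (fun x : borel_rV R d.+1 => (@enorm d.+1 x)^-1 * (x : 'rV[R]_d.+1) ord0 i)).
  apply: measurable_funM; last exact: measurable_coord.
  exact: measurableT_comp measurable_inv measurable_enorm.
by apply/funext => x; rewrite /normalize mxE.
Qed.

HB.instance Definition _ := isMeasurableFun.Build _ _ _ _ normalize
  measurable_normalize.

(* The Lebesgue measure of the cone [set t *: u | u in A `&` sphere & 0 < t <= 1]
   over [A]: up to a constant factor, the spherical Lebesgue measure of [A]. As a
   measure on the ambient space it is carried by [sphere]. *)
Definition cone_measure (A : set (borel_rV R d.+1)) : \bar R :=
  lebesgue_rV (normalize @^-1` A `&` punctured_ball).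

Let cone_measureE : cone_measure =
  pushforward (mrestr (@lebesgue_rV R d.+1) measurable_punctured_ball) normalize.
Proof. by []. Qed.

Let cone_measure0 : cone_measure set0 = 0%E.
Proof. by rewrite cone_measureE measure0. Qed.

Let cone_measure_ge0 A : (0 <= cone_measure A)%E.
Proof. exact: measure_ge0. Qed.

Let cone_measure_sigma_additive : semi_sigma_additive cone_measure.
Proof. by rewrite cone_measureE; exact: measure_semi_sigma_additive. Qed.

HB.instance Definition _ := isMeasure.Build _ _ _ cone_measure
  cone_measure0 cone_measure_ge0 cone_measure_sigma_additive.

Let total_ge0 : 0 <= (fine (cone_measure setT))^-1.
Proof. by rewrite invr_ge0 fine_ge0. Qed.

Definition sphere_measure : set (borel_rV R d.+1) -> \bar R :=
  mscale (NngNum total_ge0) cone_measure.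

HB.instance Definition _ := Measure.on sphere_measure.

Lemma sphere_measureE A :
  sphere_measure A = ((fine (cone_measure setT))^-1%:E * cone_measure A)%E.
Proof. by []. Qed.

End sphere.

Section convex_bodies.
Context (R : realType) (d : nat).
Local Notation V := 'rV[R]_d.+1.
Local Notation S := (@sphere R d).
Implicit Types (K L : set V) (F Phi Sigma theta : set V -> R).

Definition closed_convex_cone (C : set V) :=
  [/\ closed C, C 0 & forall s t x y, 0 <= s -> 0 <= t -> C x -> C y ->
    C (s *: x + t *: y)].

Definition linear_subspace (C : set V) :=
  C 0 /\ forall (s t : R) x y, C x -> C y -> C (s *: x + t *: y).

Definition convex_bodies : set (set V) :=
  [set K | exists C, [/\ closed_convex_cone C, ~ linear_subspace C &
                         K = S `&` C]].

Definition U1 K : R :=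
  2^-1 * \int[@sphere_measure R d]_(x in S)
    \1_[set x | great_hypersphere x `&` K !=set0] x.

Definition Phi2U1 K : R := 2 * U1 K.

Definition hausdorff_continuous (D : set (set V)) F :=
  forall K, D K -> forall e, 0 < e -> exists2 r, 0 < r &
    forall L, D L -> hausdorff K L < r -> `|F L - F K| < e.

(* Functionals are total functions on sets of vectors; only their values on
   [convex_bodies], and that of a size functional on the whole sphere, are
   ever used. *)
Definition size_functional Sigma :=
  [/\ hausdorff_continuous convex_bodies Sigma,
      (forall K, convex_bodies K -> 0 <= Sigma K),
      (exists2 K, convex_bodies K & Sigma K != 0) &
      (forall e, S e -> Sigma [set e] = 0)].

(* The convention extending [Sigma] to the whole sphere. *)
Definition sphere_extension Sigma :=
  forall K, convex_bodies K -> Sigma K <= Sigma S.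

Definition increasing_functional Sigma :=
  forall K L, convex_bodies K -> convex_bodies L -> K `<=` L ->
    Sigma K <= Sigma L.

Definition rotation (M : 'M[R]_d.+1) := M *m M^T = 1%:M /\ \det M = 1.

Definition rotation_invariant Sigma :=
  forall M, rotation M -> forall K, convex_bodies K ->
    Sigma [set x *m M | x in K] = Sigma K.

Definition superlevel Sigma (a : R) : set (set V) :=
  [set K | convex_bodies K /\ a <= Sigma K].

(* The infimum is a minimum when the superlevel set is nonempty, by compactness
   of [convex_bodies] for the Hausdorff metric. *)
Definition tau Phi Sigma (a : R) : R := inf [set Phi K | K in superlevel Sigma a].

Definition extremal_bodies Phi Sigma (a : R) : set (set V) :=
  [set K | superlevel Sigma a K /\ Phi K = tau Phi Sigma a].

Definition deviation_functional Phi Sigma (a : R) theta :=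
  [/\ hausdorff_continuous (superlevel Sigma a) theta,
      (forall K, superlevel Sigma a K -> 0 <= theta K) &
      (forall K, superlevel Sigma a K ->
        (theta K = 0 <-> extremal_bodies Phi Sigma a K))].

Definition stability_function Phi Sigma (a : R) theta (f : R -> R) :=
  [/\ (forall t, 0 <= t -> 0 <= f t <= 1),
      (forall s t, 0 <= s -> s <= t -> f s <= f t),
      f 0 = 0,
      (forall t, 0 < t -> 0 < f t) &
      (forall t K, 0 <= t -> superlevel Sigma a K -> t <= theta K ->
        (1 + f t) * tau Phi Sigma a <= Phi K)].

End convex_bodies.

Section tessellation.
Context (R : realType) (d : nat).
Local Notation V := 'rV[R]_d.+1.
Local Notation S := (@sphere R d).
Implicit Types (s : seq V) (p : V).

Definition cells s : set (set V) :=
  let D := S `\` \bigcup_(x in [set` s]) great_hypersphere x in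
  [set closure (connected_component D y) | y in D].

(* [within S (nbhs p) Z] : [p] is interior to [Z] relatively to the sphere. The
   default [set0] is taken when [p] lies on one of the great hyperspheres. *)
Definition crofton_cell p s : set V :=
  xget set0 [set Z | cells s Z /\ within S (nbhs p) Z].

End tessellation.

Section poisson_process.
Context (R : realType) (d : nat) (dO : measure_display)
  (Omega : measurableType dO) (P : probability Omega R).
Local Notation V := 'rV[R]_d.+1.

(* A realization is a finite counting measure on the sphere, given by the list
   of its atoms with multiplicity; the order of the list is irrelevant, since
   only the numbers of points in Borel sets are required to be measurable. *)
Definition npoints (X : Omega -> seq V) (A : set V) (w : Omega) : nat :=
  count [pred x | x \in A] (X w).

(* The second argument of [poisson_prob] is a dummy; for a null set [A] the
   rate is 0 and [poisson_prob] is the Dirac measure at 0. *)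
Definition isotropic_poisson_process (gamma : R) (X : Omega -> seq V) :=
  [/\ (forall w x, x \in X w -> sphere x),
      (forall A : set (borel_rV R d.+1), measurable A ->
        measurable_fun setT (npoints X A)),
      (forall A : set (borel_rV R d.+1), measurable A -> forall U : set nat,
        P (npoints X A @^-1` U) =
        poisson_prob (gamma * fine (sphere_measure A)) 0%N U) &
      (forall (n : nat) (A : 'I_n -> set (borel_rV R d.+1)),
        (forall i, measurable (A i)) -> trivIset setT A ->
        forall U : 'I_n -> set nat,
          P (\bigcap_(i in setT) (npoints X (A i) @^-1` U i)) =
          (\prod_(i < n) P (npoints X (A i) @^-1` U i))%E)].

(* No division by 0 for the events of interest: [size_event] contains the event
   that there is no point at all, in which case the cell is the whole sphere. *)
Definition cond_prob (A B : set Omega) : R := fine (P (A `&` B)) / fine (P B).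

Definition size_event (Sigma : set V -> R) (a : R) (Z : Omega -> set V) :
    set Omega :=
  [set w | (convex_bodies (Z w) \/ Z w = @sphere R d) /\ a <= Sigma (Z w)].

Definition deviation_event (Sigma theta : set V -> R) (a eps : R)
    (Z : Omega -> set V) : set Omega :=
  [set w | superlevel Sigma a (Z w) /\ eps <= theta (Z w)].

End poisson_process.

(* Main.v *)
(* A great hypersphere meets the convex body K exactly when its pole lies in a set of
   sigma-measure [Phi2U1 K], so a Poisson process of intensity gamma avoids that set with
   probability [expR (- gamma * Phi2U1 K)].  Rotating a body of the superlevel set so
   that it contains p and letting it vary bounds [P (Sigma(Z0) >= a)] from below by
   [expR (- gamma * tau)].

   Conversely, fix a finite net of the sphere and record the net points close to Z0.  No
   pole of the process can separate two of them by a margin, as it would then separate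
   two points of Z0.  The poles that do separate them fill a set of measure at least
   [Phi2U1 Z0] minus a multiple of the mesh, uniformly in Z0: the exceptional poles x
   have a small support function [max <x, y>] on Z0 or on - Z0, and on a line parallel to
   a coordinate axis the support function grows at a fixed rate along the largest
   coordinate of the maximizer, so the exceptional set is a finite union of thin sets.
   There are finitely many records, whence
   [P (theta(Z0) >= eps, Sigma(Z0) >= a) <= C * expR (- gamma * m')] for every m' below
   the infimum m of Phi2U1 on the deviating bodies; since f(eps) * tau <= m - tau,
   m' = tau + kappa * (m - tau) suffices.

   The events are measurable because a Hausdorff-closed condition on Z0 can be expressed
   through the points of a countable dense set that lie in its interior, and such a point
   lies there if and only if no pole separates it weakly from p. *)
Require Import Defs.
From HB Require Import structures.
From mathcomp Require Import all_boot all_order all_algebra.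
From mathcomp Require Import all_classical all_reals all_analysis.
From mathcomp Require Import measurable_realfun.
From mathcomp Require Import ring lra.
Set Implicit Arguments. Unset Strict Implicit. Unset Printing Implicit Defensive.
Import Order.TTheory GRing.Theory Num.Theory.
Import numFieldNormedType.Exports.
Local Open Scope classical_set_scope.
Local Open Scope ring_scope.

(** * Shears and translations preserve Lebesgue measure *)

Section lebesgue_translation.
Context {R : realType}.
Local Notation lambda := (@lebesgue_measure R).

(** The pushforward of [lambda] under a translation agrees with [lambda] on half-open intervals, so
    uniqueness of Lebesgue measure applies. *)
Lemma lebesgue_measure_translation (c : R) (A : set R) : measurable A ->
  lambda [set x | A (x + c)] = lambda A.
Proof.
move=> mA.
have mc : measurable_fun setT (fun x : measurableTypeR R => (x + c : measurableTypeR R)).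
  exact: measurable_funD.
pose f : {mfun (measurableTypeR R) >-> (measurableTypeR R)} := HB.pack
  (fun x : measurableTypeR R => (x + c : measurableTypeR R))
  (isMeasurableFun.Build _ _ _ _ _ mc).
rewrite [RHS](@lebesgue_measure_unique R (pushforward lambda f))//.
move=> _ [[a b] _ <-] /=; rewrite /pushforward.
rewrite (_ : _ @^-1` _ = `]a - c, b - c]%classic); last first.
  by apply/seteqP; split => x /=; rewrite !in_itv/= ltrBlDr lerBrDr.
by rewrite [LHS]lebesgue_measure_itv [RHS]lebesgue_measure_itv/= !lte_fin ltrD2r
  -!EFinD; case: ifP => // _; congr EFin; ring.
Qed.

End lebesgue_translation.

(** * Tonelli's theorem for rows, and invariance under shears *)

Section lebesgue_rV_sections.
Context {R : realType}.
Local Notation lambda := (@lebesgue_measure R).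
Local Notation mu := (tuple_measure (@lebesgue_measure R)).

(** Row counterpart of [tuple_cons], the step by which [tuple_measure] is built; all inductions on
    the dimension split a row this way. *)
Definition row_cons n (x : R) (v : 'rV[R]_n) : 'rV[R]_n.+1 :=
  row_mx (x%:M : 'rV_1) v.

Lemma row_cons0 n x (v : 'rV[R]_n) : row_cons x v ord0 ord0 = x.
Proof.
have -> : ord0 = lshift n ord0 :> 'I_(1 + n) by exact: val_inj.
by apply: etrans (row_mxEl _ _ _ _) _; rewrite mxE.
Qed.

Lemma row_consS n x (v : 'rV[R]_n) i : row_cons x v ord0 (lift ord0 i) = v ord0 i.
Proof.
have -> : lift ord0 i = rshift 1 i :> 'I_(1 + n) by exact: val_inj.
exact: row_mxEr.
Qed.

Lemma row_consP n (w : 'rV[R]_n.+1) :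
  w = row_cons (w ord0 ord0) (\row_i w ord0 (lift ord0 i)).
Proof.
apply/rowP => i; case: (unliftP ord0 i) => [j|] ->; last by rewrite row_cons0.
by rewrite row_consS mxE.
Qed.

Lemma row_consD n x y (u v : 'rV[R]_n) :
  row_cons x u + row_cons y v = row_cons (x + y) (u + v).
Proof.
apply/rowP => i; rewrite mxE; case: (unliftP ord0 i) => [j|] ->.
  by rewrite !row_consS mxE.
by rewrite !row_cons0.
Qed.

Lemma measurable_row_cons n d (T : measurableType d) (f : T -> R)
    (g : T -> borel_rV R n) :
  measurable_fun setT f -> measurable_fun setT g ->
  measurable_fun setT (fun t => row_cons (f t) (g t) : borel_rV R n.+1).
Proof.
move=> mf mg; apply: measurable_fun_rV => i.
case: (unliftP ord0 i) => [j|] ->.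
  under eq_fun do rewrite row_consS.
  exact: measurableT_comp (measurable_coord j) mg.
by under eq_fun do rewrite row_cons0.
Qed.

Lemma measurable_preimage d1 d2 (T1 : measurableType d1) (T2 : measurableType d2)
    (f : T1 -> T2) (A : set T2) :
  measurable_fun setT f -> measurable A -> measurable (f @^-1` A).
Proof. by move=> mf mA; rewrite -[X in measurable X]setTI; exact: mf. Qed.

Lemma tuple_rV_cons n (x : measurableTypeR R) (t : n.-tuple (measurableTypeR R)) :
  tuple_rV (tuple_cons (x, t)) = row_cons x (tuple_rV t).
Proof.
apply/rowP => i; rewrite mxE; case: (unliftP ord0 i) => [j|] ->.
  by rewrite row_consS mxE tnthS.
by rewrite row_cons0 tnth0.
Qed.

Let section_set n (A : set (borel_rV R n.+1)) :
  set (measurableTypeR R * n.-tuple (measurableTypeR R)) :=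
  [set u | A (row_cons u.1 (tuple_rV u.2))].

Let measurable_section_set n (A : set (borel_rV R n.+1)) :
  measurable A -> measurable (section_set A).
Proof.
move=> mA; apply: (measurable_preimage _ mA).
apply: measurable_row_cons; first exact: measurable_fst.
by apply: measurableT_comp; [exact: measurable_tuple_rV|exact: measurable_snd].
Qed.

Let lebesgue_rV_prod n (A : set (borel_rV R n.+1)) :
  lebesgue_rV A = (lambda \x mu n)%E (section_set A).
Proof.
rewrite /lebesgue_rV /pushforward /= /cons_measure /pushforward.
congr (product_measure1 _ _ _); apply/seteqP; split => -[x t];
  by rewrite /section_set/= tuple_rV_cons.
Qed.

Lemma lebesgue_rV_first n (A : set (borel_rV R n.+1)) : measurable A ->
  lebesgue_rV A =
  (\int[lambda]_x lebesgue_rV ([set v | A (row_cons x v)] : set (borel_rV R n)))%E.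
Proof.
move=> mA; rewrite lebesgue_rV_prod /product_measure1.
apply: eq_integral => x _ /=; congr (mu n _).
by rewrite xsectionE.
Qed.

(** Integration over the first coordinate last is the definition of the product measure; this
    opposite order is Tonelli's theorem. *)
Lemma lebesgue_rV_last n (A : set (borel_rV R n.+1)) : measurable A ->
  lebesgue_rV A =
  (\int[mu n]_t lambda [set x | A (row_cons x (tuple_rV t))])%E.
Proof.
move=> mA; rewrite lebesgue_rV_prod.
have mS := measurable_section_set mA.
rewrite -[section_set A in LHS]setIT -integral_indic//.
rewrite fubini_tonelli2//=; last exact/measurable_EFinP.
apply: eq_integral => t _; rewrite /fubini_G.
have mt : measurable (ysection (section_set A) t) by exact: measurable_ysection.
rewrite (_ : [set _ | _] = ysection (section_set A) t `&` setT); last first.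
  by rewrite setIT ysectionE.
rewrite -integral_indic//; apply: eq_integral => x _.
by rewrite !indicE mem_ysection.
Qed.

Lemma measurable_lebesgue_first n (A : set (borel_rV R n.+1)) : measurable A ->
  measurable_fun setT (fun x : measurableTypeR R =>
    lebesgue_rV ([set v | A (row_cons x v)] : set (borel_rV R n))).
Proof.
move=> /measurable_section_set/(@measurable_fun_xsection _ _ _ _ _ (mu n)).
by apply: eq_measurable_fun => x _ /=; congr (mu n _); rewrite xsectionE.
Qed.

Lemma measurable_lebesgue_last n (A : set (borel_rV R n.+1)) : measurable A ->
  measurable_fun setT (fun t : n.-tuple (measurableTypeR R) =>
    lambda [set x | A (row_cons x (tuple_rV t))]).
Proof.
move=> /measurable_section_set/(@measurable_fun_ysection _ _ _ _ _ lambda).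
by apply: eq_measurable_fun => t _ /=; congr (lambda _); rewrite ysectionE.
Qed.

Lemma measurable_section_first n (A : set (borel_rV R n.+1)) x : measurable A ->
  measurable ([set v | A (row_cons x v)] : set (borel_rV R n)).
Proof.
move=> mA; apply: (measurable_preimage _ mA).
by apply: measurable_row_cons => //; exact: measurable_id.
Qed.

Lemma measurable_section_last n (A : set (borel_rV R n.+1)) v : measurable A ->
  measurable [set x | A (row_cons x v)].
Proof.
move=> mA; apply: (measurable_preimage _ mA); exact: measurable_row_cons.
Qed.

(** On each line parallel to the first axis the map is a translation by the constant [phi v], so
    Tonelli reduces the claim to dimension one. *)
Lemma lebesgue_rV_shear_first n (phi : 'rV[R]_n -> R)
    (A : set (borel_rV R n.+1)) (f : borel_rV R n.+1 -> borel_rV R n.+1) :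
  measurable_fun setT f ->
  (forall x v, f (row_cons x v) = row_cons (x + phi v) v) ->
  measurable A -> lebesgue_rV (f @^-1` A) = lebesgue_rV A.
Proof.
move=> mf fE mA; rewrite !lebesgue_rV_last//; last exact: measurable_preimage.
apply: eq_integral => t _.
rewrite -[RHS](lebesgue_measure_translation (phi (tuple_rV t))); last first.
  exact: measurable_section_last.
by congr lambda; apply/seteqP; split => x /=; rewrite fE.
Qed.

(** Induction on the dimension: the first coordinate is shifted by a shear of constant displacement,
    the others slice by slice through the induction hypothesis. *)
Lemma lebesgue_rV_translation n (b : 'rV[R]_n) (A : set (borel_rV R n)) :
  measurable A ->
  lebesgue_rV ([set v | A (v + b)] : set (borel_rV R n)) = lebesgue_rV A.
Proof.
elim: n b A => [|n IHn] b A mA.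
  by congr lebesgue_rV; apply/seteqP; split => v /=; rewrite [v + b]thinmx0 [v]thinmx0.
pose b0 := b ord0 ord0; pose b' : 'rV[R]_n := \row_i b ord0 (lift ord0 i).
have mT c : measurable_fun setT (fun w : borel_rV R n.+1 => (w + c : borel_rV R n.+1)).
  apply: measurable_fun_rV => i; under eq_fun do rewrite mxE.
  by apply: measurable_funD => //; exact: measurable_coord.
rewrite -[RHS](@lebesgue_rV_shear_first _ (fun=> b0) A (fun w => w + row_cons b0 0))//;
  last by move=> x v; rewrite row_consD addr0.
have mB := measurable_preimage (mT (row_cons b0 0)) mA.
rewrite [RHS]lebesgue_rV_first// lebesgue_rV_first; last exact: measurable_preimage (mT b) mA.
apply: eq_integral => x _; rewrite -[RHS](IHn b'); last exact: measurable_section_first.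
congr lebesgue_rV; apply/seteqP; split => v /=; rewrite !row_consD addr0 {1}(row_consP b) row_consD;
  exact.
Qed.

Lemma lebesgue_rV_shear_rest n (psi : R -> 'rV[R]_n)
    (A : set (borel_rV R n.+1)) (f : borel_rV R n.+1 -> borel_rV R n.+1) :
  measurable_fun setT f ->
  (forall x v, f (row_cons x v) = row_cons x (v + psi x)) ->
  measurable A -> lebesgue_rV (f @^-1` A) = lebesgue_rV A.
Proof.
move=> mf fE mA; rewrite !lebesgue_rV_first//; last exact: measurable_preimage.
apply: eq_integral => x _.
rewrite -[RHS](lebesgue_rV_translation (psi x)); last exact: measurable_section_first.
by congr lebesgue_rV; apply/seteqP; split => v /=; rewrite fE.
Qed.

End lebesgue_rV_sections.

(** * Rotations of the sphere *)

Section dot_product.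
Context {R : realType} {n : nat}.
Implicit Types (x y z : 'rV[R]_n) (a : R).

Lemma dotvE x y : dotv x y = (x *m y^T) ord0 ord0.
Proof. by rewrite mxE; apply: eq_bigr => i _; rewrite mxE. Qed.

Lemma dotvC x y : dotv x y = dotv y x.
Proof. by apply: eq_bigr => i _; rewrite mulrC. Qed.

Lemma dotvDr x y z : dotv x (y + z) = dotv x y + dotv x z.
Proof. by rewrite !dotvE linearD/= mulmxDr mxE. Qed.

Lemma dotvZr a x y : dotv x (a *: y) = a * dotv x y.
Proof. by rewrite !dotvE linearZ/= -scalemxAr mxE. Qed.

Lemma dotvDl x y z : dotv (y + z) x = dotv y x + dotv z x.
Proof. by rewrite dotvC dotvDr !(dotvC x). Qed.

Lemma dotvZl a x y : dotv (a *: y) x = a * dotv y x.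
Proof. by rewrite dotvC dotvZr dotvC. Qed.

Lemma dotvNr x y : dotv x (- y) = - dotv x y.
Proof. by rewrite -scaleN1r dotvZr mulN1r. Qed.

Lemma dotvNl x y : dotv (- y) x = - dotv y x.
Proof. by rewrite dotvC dotvNr dotvC. Qed.

Lemma dotvBr x y z : dotv x (y - z) = dotv x y - dotv x z.
Proof. by rewrite dotvDr dotvNr. Qed.

Lemma dotv0r x : dotv x 0 = 0.
Proof. by rewrite -(scale0r 0) dotvZr mul0r. Qed.

Lemma dotv_ge0 x : 0 <= dotv x x.
Proof. by apply: sumr_ge0 => i _; rewrite -expr2 sqr_ge0. Qed.

Lemma dotv_eq0 x : dotv x x = 0 -> x = 0.
Proof.
move=> /eqP; rewrite psumr_eq0 => [/allP x0|i _]; last by rewrite -expr2 sqr_ge0.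
apply/rowP => i; rewrite mxE; apply/eqP.
by have := x0 i (mem_index_enum _); rewrite -expr2 sqrf_eq0.
Qed.

Lemma enorm_ge0 x : 0 <= enorm x. Proof. exact: sqrtr_ge0. Qed.

Lemma sqr_enorm x : enorm x ^+ 2 = dotv x x.
Proof. by rewrite sqr_sqrtr// dotv_ge0. Qed.

Lemma enormZ a x : enorm (a *: x) = `|a| * enorm x.
Proof.
by rewrite /enorm dotvZl dotvZr mulrA -expr2 sqrtrM ?sqr_ge0// sqrtr_sqr.
Qed.

Lemma dotv_mulmx (M : 'M[R]_n) x y : M *m M^T = 1%:M ->
  dotv (x *m M) (y *m M) = dotv x y.
Proof.
by move=> MM; rewrite !dotvE trmx_mul mulmxA -(mulmxA x) MM mulmx1.
Qed.

(** The entries of [M *m M^T] are the scalar products of the images of the basis vectors. *)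
Lemma orthogonalP (M : 'M[R]_n) :
  (forall x y, dotv (x *m M) (y *m M) = dotv x y) -> M *m M^T = 1%:M.
Proof.
move=> MM; apply/matrixP => i j.
have := MM (delta_mx ord0 i) (delta_mx ord0 j).
rewrite -!rowE dotvE; congr (_ = _).
  by rewrite mxE [RHS]mxE; apply: eq_bigr => k _; rewrite !mxE.
rewrite dotvE trmx_delta mul_delta_mx_cond [RHS]mxE.
by case: (i == j); rewrite ?mulr1n ?mulr0n mxE ?eqxx.
Qed.

End dot_product.

(** * Transitivity on the sphere by products of shears *)

Section sphere_rotations.
Context {R : realType}.

Lemma dotv_row_cons n x y (v w : 'rV[R]_n) :
  dotv (row_cons x v) (row_cons y w) = x * y + dotv v w.
Proof.
rewrite /dotv big_ord_recl !row_cons0; congr (_ + _).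
by apply: eq_bigr => i _; rewrite !row_consS.
Qed.

Lemma sphereE d (x : 'rV[R]_d.+1) : sphere x <-> dotv x x = 1.
Proof.
rewrite -sqr_enorm /sphere/=; split => [->|/eqP]; first by rewrite expr1n.
by rewrite sqrf_eq1 => /orP[/eqP//|/eqP x1]; have := enorm_ge0 x; rewrite x1 ler0N1.
Qed.

Lemma measurable_mulmx m n (M : 'M[R]_(m, n)) :
  measurable_fun setT (fun w : borel_rV R m => w *m M : borel_rV R n).
Proof.
apply: measurable_fun_rV => i; under eq_fun do rewrite mxE.
apply: measurable_sum => j; apply: measurable_funM => //.
exact: measurable_coord.
Qed.

Definition lebesgue_preserving n (M : 'M[R]_n) :=
  forall A : set (borel_rV R n), measurable A ->
    lebesgue_rV ([set w | A (w *m M)] : set (borel_rV R n)) = lebesgue_rV A.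

Lemma lebesgue_preserving_mul n (M N : 'M[R]_n) :
  lebesgue_preserving M -> lebesgue_preserving N -> lebesgue_preserving (M *m N).
Proof.
move=> pM pN A mA.
rewrite -[RHS]pN// -[RHS]pM; last exact: (measurable_preimage (measurable_mulmx N)).
by congr lebesgue_rV; apply/seteqP; split => w /=; rewrite mulmxA.
Qed.

Definition shear_first n (c : R) (u : 'rV[R]_n) : 'M[R]_n.+1 :=
  block_mx (1%:M : 'M[R]_1) 0 (c *: u^T) 1%:M.

Definition shear_rest n (s : R) (u : 'rV[R]_n) : 'M[R]_n.+1 :=
  block_mx (1%:M : 'M[R]_1) (s *: u) 0 1%:M.

Lemma mul_shear_first n c (u : 'rV[R]_n) x v :
  row_cons x v *m shear_first c u = row_cons (x + c * dotv v u) v.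
Proof.
apply: (etrans (mul_row_block (x%:M : 'rV[R]_1) v 1%:M 0 (c *: u^T) 1%:M)).
rewrite mulmx0 !mulmx1 add0r /row_cons; congr row_mx.
apply/rowP => i; rewrite ord1 dotvE -scalemxAr [LHS]mxE [X in X + _]mxE.
by rewrite [X in _ + X]mxE [RHS]mxE.
Qed.

Lemma mul_shear_rest n s (u : 'rV[R]_n) x v :
  row_cons x v *m shear_rest s u = row_cons x (v + (x * s) *: u).
Proof.
apply: (etrans (mul_row_block (x%:M : 'rV[R]_1) v 1%:M (s *: u) 0 1%:M)).
by rewrite mulmx0 !mulmx1 addr0 /row_cons mul_scalar_mx scalerA addrC.
Qed.

Lemma lebesgue_preserving_shear_first n c (u : 'rV[R]_n) :
  lebesgue_preserving (shear_first c u).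
Proof.
move=> A mA.
apply: (lebesgue_rV_shear_first (phi := fun v => c * dotv v u)) => //.
  exact: measurable_mulmx.
by move=> x v; rewrite mul_shear_first.
Qed.

Lemma lebesgue_preserving_shear_rest n s (u : 'rV[R]_n) :
  lebesgue_preserving (shear_rest s u).
Proof.
move=> A mA.
apply: (lebesgue_rV_shear_rest (psi := fun x => (x * s) *: u)) => //.
  exact: measurable_mulmx.
by move=> x v; rewrite mul_shear_rest.
Qed.

Lemma det_shear_first n c (u : 'rV[R]_n) : \det (shear_first c u) = 1.
Proof. by apply: (etrans (det_lblock (1%:M : 'M[R]_1) _ _)); rewrite !det1 mulr1. Qed.

Lemma det_shear_rest n c (u : 'rV[R]_n) : \det (shear_rest c u) = 1.
Proof. by apply: (etrans (det_ublock (1%:M : 'M[R]_1) _ _)); rewrite !det1 mulr1. Qed.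

Variable d : nat.
Local Notation V := 'rV[R]_d.+1.

(** Invariance of Lebesgue measure is carried along with the rotation, since it is obtained from the
    factorization into shears. *)
Definition preserving_rotation (M : 'M[R]_d.+1) :=
  rotation M /\ lebesgue_preserving M.

Definition rotates (p q : V) := exists2 M, preserving_rotation M & p *m M = q.

Lemma rotates_refl p : rotates p p.
Proof.
exists 1%:M; last by rewrite mulmx1.
split; first by rewrite /rotation trmx1 mulmx1 det1.
by move=> A mA; congr lebesgue_rV; apply/seteqP; split => w /=; rewrite mulmx1.
Qed.

Lemma rotates_sym p q : rotates p q -> rotates q p.
Proof.
move=> [M [[MM detM] pM] <-]; exists M^T; last by rewrite -mulmxA MM mulmx1.
split; first by rewrite /rotation trmxK (mulmx1C MM) det_tr.
move=> A mA; rewrite -[LHS]pM; last exact: (measurable_preimage (measurable_mulmx M^T)).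
by congr lebesgue_rV; apply/seteqP; split => w /=; rewrite -mulmxA MM mulmx1.
Qed.

Lemma rotates_trans p q r : rotates p q -> rotates q r -> rotates p r.
Proof.
move=> [M [[MM detM] pM] <-] [N [[NN detN] pN] <-].
exists (M *m N); last by rewrite mulmxA.
split; last exact: lebesgue_preserving_mul.
rewrite /rotation det_mulmx detM detN mulr1 trmx_mul mulmxA -(mulmxA M) NN.
by rewrite mulmx1.
Qed.

(* A plane rotation is a product of three shears. *)
Lemma plane_rotation (c s : R) (u : 'rV[R]_d) :
  c ^+ 2 + s ^+ 2 = 1 -> c != -1 -> dotv u u = 1 ->
  exists2 M, preserving_rotation M &
    forall x v, row_cons x v *m M =
      row_cons (c * x - s * dotv v u) (v + (s * x + (c - 1) * dotv v u) *: u).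
Proof.
(* [t] is minus the tangent of half the rotation angle; [c1] excludes the half turn, where it is
   infinite. *)
move=> cs c1 uu; pose t := - s / (1 + c).
have c1' : 1 + c != 0 by rewrite addrC -(opprK 1) subr_eq0.
have s2 : s ^+ 2 = (1 - c) * (1 + c) by rewrite -subr_sqr expr1n -cs; ring.
have st : s * t = c - 1.
  by rewrite /t mulrA mulrN -expr2 s2 mulNr mulfK// opprB.
have tE : t * (1 + c) = - s by rewrite /t divfK.
pose M := shear_first t u *m shear_rest s u *m shear_first t u.
have ME x v : row_cons x v *m M =
    row_cons (c * x - s * dotv v u) (v + (s * x + (c - 1) * dotv v u) *: u).
  rewrite /M !mulmxA mul_shear_first mul_shear_rest mul_shear_first.
  rewrite dotvDl dotvZl uu mulr1; set a := dotv v u.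
  have -> : (x + t * a) * s = s * x + (c - 1) * a by rewrite -st; ring.
  congr row_cons; transitivity ((1 + s * t) * x + (t * (1 + c)) * a); last first.
    by rewrite tE st; ring.

  ring.
exists M => //; split; last first.
  have p1 := @lebesgue_preserving_shear_first _ t u.
  have p2 := @lebesgue_preserving_shear_rest _ s u.
  exact: (lebesgue_preserving_mul (lebesgue_preserving_mul p1 p2) p1).
split; last by rewrite !det_mulmx !det_shear_first det_shear_rest !mulr1.
apply: orthogonalP => x y; rewrite (row_consP x) (row_consP y) !ME.
set x0 := x _ _; set y0 := y _ _; set v := \row_i _; set w := \row_i _.
rewrite !dotv_row_cons !dotvDl !dotvDr !dotvZl !dotvZr uu (dotvC u w).
set a := dotv v u; set b := dotv w u; set e := dotv v w.
transitivity ((c ^+ 2 + s ^+ 2) * (x0 * y0) + e + (c ^+ 2 + s ^+ 2 - 1) * (a * b)); first by ring.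
by rewrite cs; ring.
Qed.

(** Rotation in the plane spanned by the first axis and the rest [v] of [q]: the cosine is the first
    coordinate of [q] and the sine is the norm of [v]. *)
Lemma rotates_first (q : V) : sphere q -> q ord0 ord0 != -1 ->
  rotates (row_cons 1 0) q.
Proof.
move=> /sphereE; rewrite (row_consP q) row_cons0.
set c := q _ _; set v := \row_i _; rewrite dotv_row_cons -expr2 => cv c1.
have [v0|v0] := eqVneq v 0.
  move: cv => /eqP; rewrite v0 dotv0r addr0 sqrf_eq1 (negbTE c1) orbF => /eqP ->.
  exact: rotates_refl.
have vv : 0 < dotv v v.
  by rewrite lt_neqAle dotv_ge0 andbT eq_sym; apply: contra_neq v0 => /dotv_eq0.
have e0 : enorm v != 0 by rewrite gt_eqF// sqrtr_gt0.
have cs : c ^+ 2 + enorm v ^+ 2 = 1 by rewrite sqr_enorm.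
have uu : dotv ((enorm v)^-1 *: v) ((enorm v)^-1 *: v) = 1.
  by rewrite dotvZl dotvZr -sqr_enorm; field.
have [M pM ME] := plane_rotation cs c1 uu.
exists M => //; rewrite ME dotvC dotv0r !mulr0 subr0 addr0 !mulr1 add0r scalerA.
by rewrite divff// scale1r.
Qed.

Lemma sphereN (x : V) : sphere x -> sphere (- x).
Proof. by move=> /sphereE x1; apply/sphereE; rewrite dotvNl dotvNr opprK. Qed.

End sphere_rotations.

Lemma sphere_rotates (R : realType) d (p q : 'rV[R]_d.+2) :
  sphere p -> sphere q -> rotates p q.
Proof.
pose e : 'rV[R]_d.+2 := row_cons 1 0.
suff H (r : 'rV[R]_d.+2) : sphere r -> rotates e r.
  by move=> Sp Sq; apply: rotates_trans (rotates_sym (H _ Sp)) (H _ Sq).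
move=> Sr; have [r0|] := eqVneq (r ord0 ord0) (-1); last exact: rotates_first.
(* The antipode of [e] is reached in two steps: [e] is carried to [- u], and the inverse of a
   rotation from [e] to [u] carries [- u] to [- e]. *)
pose u : 'rV[R]_d.+2 := row_cons 0 (row_cons 1 0).
have Su : sphere u by apply/sphereE; rewrite !dotv_row_cons dotv0r; ring.
have u0 : u ord0 ord0 != -1 by rewrite row_cons0 eq_sym oppr_eq0 oner_eq0.
have nu0 : (- u) ord0 ord0 != -1 by rewrite mxE row_cons0 oppr0 eq_sym oppr_eq0 oner_eq0.
have -> : r = - e.
  move/sphereE: Sr; rewrite (row_consP r) r0; set v := \row_i _.
  rewrite dotv_row_cons mulrNN mulr1 -[RHS]addr0 => /addrI /dotv_eq0 ->.
  by apply/rowP => i; rewrite [RHS]mxE; case: (unliftP ord0 i) => [j|] ->;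
    rewrite ?row_consS ?row_cons0// mxE oppr0.
have [M pM Mu] := rotates_first Su u0.
apply: rotates_trans (rotates_first (sphereN Su) nu0) _; apply: rotates_sym.
by exists M => //; rewrite mulNmx Mu.
Qed.

(** * Rotation invariance of the spherical measure *)

Section rotation_invariance.
Context {R : realType} {d : nat}.
Local Notation V := 'rV[R]_d.+1.

(** An orthogonal matrix preserves the norm, hence it commutes with [normalize] and preserves the
    punctured ball; the rest is invariance of Lebesgue measure. *)
Lemma sphere_measure_rotation (M : 'M[R]_d.+1) (A : set (borel_rV R d.+1)) :
  preserving_rotation M -> measurable A ->
  sphere_measure ([set w | A (w *m M)] : set (borel_rV R d.+1)) = sphere_measure A.
Proof.
move=> [[MM _] pM] mA; rewrite !sphere_measureE; congr (_ * _)%E.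
have mB : measurable ((@normalize R d) @^-1` A `&` @punctured_ball R d).
  apply: measurableI; last exact: measurable_punctured_ball.
  exact: measurable_preimage (@measurable_normalize R d) mA.
rewrite /cone_measure -[RHS]pM//; congr lebesgue_rV.
have eM (w : V) : enorm (w *m M) = enorm w by rewrite /enorm dotv_mulmx.
by apply/seteqP; split => w /=; rewrite /normalize /punctured_ball/= eM -scalemxAl.
Qed.

Lemma sphere_mulmx (M : 'M[R]_d.+1) (x : V) : M *m M^T = 1%:M ->
  sphere (x *m M) <-> sphere x.
Proof. by move=> MM; rewrite !sphereE dotv_mulmx. Qed.

Lemma rotation_tr (M : 'M[R]_d.+1) : rotation M -> M^T *m M = 1%:M.
Proof. by move=> [MM _]; exact: mulmx1C. Qed.

End rotation_invariance.

(** * Sets with short sections parallel to an axis *)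

Section line_sections.
Context {R : realType}.
Local Notation lambda := (@lebesgue_measure R).
Local Notation mu := (tuple_measure (@lebesgue_measure R)).

Lemma ge0_integral_le_cst d (T : measurableType d) (m : {measure set T -> \bar R})
    (D : set T) (f : T -> \bar R) (c : R) :
  measurable D -> measurable_fun setT f -> (forall x, 0 <= f x)%E ->
  (forall x, ~ D x -> f x = 0%E) -> (forall x, f x <= c%:E)%E ->
  (\int[m]_x f x <= c%:E * m D)%E.
Proof.
move=> mD mf f0 fD fc; have -> : (\int[m]_x f x = \int[m]_(x in D) f x)%E.
  rewrite [RHS]integral_mkcond; apply: eq_integral => x _; rewrite patchE.
  by case: ifPn => // /negP; rewrite inE => /fD.
rewrite -integral_cst//; apply: ge0_le_integral => //; exact: measurable_funTS.
Qed.

Definition unit_box n : set (borel_rV R n) :=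
  [set v | forall i, -1 <= (v : 'rV[R]_n) ord0 i <= 1].
Arguments unit_box : clear implicits.

Lemma measurable_unit_box n : measurable (unit_box n).
Proof.
rewrite (_ : unit_box n = \bigcap_(i in [set: 'I_n])
   ((fun v : borel_rV R n => (v : 'rV[R]_n) ord0 i) @^-1` `[-1, 1])).
  by apply: fin_bigcap_measurable => // i _;
    apply: measurable_preimage => //; exact: measurable_coord.
apply/seteqP; split => v /= H i; first by move=> _; rewrite /= in_itv/= H.
by have := H i I; rewrite /= in_itv.
Qed.

Lemma unit_box_cons n x (v : 'rV[R]_n) :
  unit_box n.+1 (row_cons x v) <-> (-1 <= x <= 1) /\ unit_box n v.
Proof.
split=> [H|[x1 v1] i].
  split; first by have := H ord0; rewrite row_cons0.
  by move=> i; have := H (lift ord0 i); rewrite row_consS.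
by case: (unliftP ord0 i) => [j|] ->; rewrite ?row_consS ?row_cons0.
Qed.

Lemma lebesgue_itvN11 : lambda `[(-1 : R), 1] = 2%:E.
Proof.
by rewrite lebesgue_measure_itv/= lte_fin ifT -?EFinB; [congr EFin; ring|lra].
Qed.

Lemma lebesgue_rV_first_le n (A : set (borel_rV R n.+1)) (l : R) :
  measurable A -> A `<=` unit_box n.+1 ->
  (forall x, lebesgue_rV ([set v | A (row_cons x v)] : set (borel_rV R n)) <= l%:E)%E ->
  (lebesgue_rV A <= (2 * l)%:E)%E.
Proof.
move=> mA Abox Al; rewrite lebesgue_rV_first// mulrC EFinM -lebesgue_itvN11.
apply: ge0_integral_le_cst => //; first exact: measurable_lebesgue_first.
move=> x xD; rewrite (_ : mkset _ = set0) ?measure0//.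
apply/seteqP; split => // v /= /Abox/unit_box_cons[x1 _]; apply: xD.
by rewrite /= in_itv.
Qed.

Lemma lebesgue_rV_unit_box n : (lebesgue_rV (unit_box n) <= (2 ^+ n)%:E)%E.
Proof.
elim: n => [|n IHn].
  rewrite expr0 [lebesgue_rV _](_ : _ =
    dirac ([tuple] : 0.-tuple (measurableTypeR R)) (@tuple_rV R 0 @^-1` unit_box 0))//.
  by rewrite diracE lee_fin lern1 leq_b1.
rewrite exprS; apply: lebesgue_rV_first_le => //; first exact: measurable_unit_box.
move=> x; apply: le_trans IHn; apply: le_measure; rewrite ?inE.
- by apply: measurable_section_first; exact: measurable_unit_box.
- exact: measurable_unit_box.
- by move=> v /= /unit_box_cons[].
Qed.

(** The factor 2 comes from enclosing [A] in the interval of radius [r] around one of its points. *)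
Lemma lebesgue_measure_diameter_le (A : set R) (r : R) : measurable A ->
  (forall x y, A x -> A y -> `|x - y| <= r) -> 0 <= r -> (lambda A <= (2 * r)%:E)%E.
Proof.
move=> mA Ar r0; have [[x Ax]|/set0P/negP/negPn/eqP ->] := pselect (A !=set0); last first.
  by rewrite measure0 lee_fin mulr_ge0.
apply: (@le_trans _ _ (lambda `[x - r, x + r])).
  apply: le_measure; rewrite ?inE//.
  by move=> y Ay; rewrite /= in_itv/= -ler_distlC Ar.
rewrite lebesgue_measure_itv/= lte_fin; case: ifP => _; last by rewrite lee_fin mulr_ge0.
by rewrite -EFinB lee_fin; lra.
Qed.

(** Induction on the dimension. If [i] is not the first axis, integration over the first coordinate
    costs a factor 2; if it is, sections of measure at most [2 * r] are integrated over the unit box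
    of the other coordinates. *)
Lemma lebesgue_rV_thin n (i : 'I_n) (A : set (borel_rV R n)) (r : R) :
  measurable A -> A `<=` unit_box n -> 0 <= r ->
  (forall v w : 'rV[R]_n, A v -> A w ->
    (forall j, j != i -> v ord0 j = w ord0 j) -> `|v ord0 i - w ord0 i| <= r) ->
  (lebesgue_rV A <= (2 ^+ n * r)%:E)%E.
Proof.
elim: n i A => [[]//|n IHn] i A mA Abox r0 Ar.
case: (unliftP ord0 i) => [k iE|iE]; subst i.
  rewrite exprS -mulrA; apply: lebesgue_rV_first_le => // x.
  apply: (IHn k) => //.
  - exact: measurable_section_first.
  - by move=> v /= /Abox/unit_box_cons[].
  - move=> v w /= Av Aw vw; have := Ar _ _ Av Aw; rewrite !row_consS; apply.
    move=> j; case: (unliftP ord0 j) => [l|] ->; rewrite ?row_consS ?row_cons0//.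
    by move=> lk; apply: vw; apply: contra_neq lk => ->.
rewrite lebesgue_rV_last//.
have m2 := measurable_preimage (@measurable_tuple_rV R n) (@measurable_unit_box n).
apply: (@le_trans _ _ ((2 * r)%:E * lebesgue_rV (unit_box n))%E); last first.
  rewrite exprSr -mulrA [leRHS]EFinM muleC; apply: lee_wpmul2r => //.
    by rewrite lee_fin mulr_ge0.
  exact: lebesgue_rV_unit_box.
apply: ge0_integral_le_cst => //; first exact: measurable_lebesgue_last.
- move=> t tD; rewrite (_ : mkset _ = set0) ?measure0//.
  by apply/seteqP; split => // v /= /Abox/unit_box_cons[_ /tD].
- move=> t; apply: lebesgue_measure_diameter_le => //.
    exact: measurable_section_last.
  move=> x y Ax Ay; have := Ar _ _ Ax Ay; rewrite !row_cons0; apply.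
  by move=> j; case: (unliftP ord0 j) => [l|] ->; rewrite ?row_consS// eqxx.
Qed.

End line_sections.

(** * The sphere and its convex bodies *)

Section sphere_topology.
Context {R : realType} {n : nat}.
Implicit Types x y z : 'rV[R]_n.

Lemma ler_coord_norm x i : `|x ord0 i| <= `|x|.
Proof.
rewrite (_ : `|x| = mx_norm x)// mx_normrE;
by apply/bigmax_geP; right; exists (ord0, i).
Qed.

Lemma ler_dotv_norm x y : `|dotv x y| <= n%:R * (`|x| * `|y|).
Proof.
apply: le_trans (ler_norm_sum _ _ _) _.
rewrite (_ : n%:R * _ = \sum_(i < n) `|x| * `|y|); last first.
  by rewrite sumr_const card_ord mulr_natl.
apply: ler_sum => i _.
by rewrite normrM ler_pM// ler_coord_norm.
Qed.

Lemma lipschitz_continuous (W : normedModType R) (f : 'rV[R]_n -> W) (k : R) :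
  (forall x y, `|f x - f y| <= k * `|x - y|) -> continuous f.
Proof.
move=> fk x; have k1 : 0 < `|k| + 1 by rewrite ltr_wpDl.
apply/(@cvgrPdist_lt _ _ _ _ (nbhs_filter x)) => e e0.
have : nbhs x (ball x (e / (`|k| + 1))) by apply: nbhsx_ballx; rewrite divr_gt0.
apply: filterS => y; rewrite -ball_normE/= ltr_pdivlMr// mulrC => xy.
apply: le_lt_trans (fk _ _) _; apply: le_lt_trans xy.
by rewrite ler_wpM2r// (le_trans (ler_norm k))// lerDl.
Qed.

Lemma mulmx_continuous m (M : 'M[R]_(n, m)) : continuous (fun x => x *m M : 'rV[R]_m).
Proof.
apply: (@lipschitz_continuous _ _ (n%:R * `|M|)) => x y; rewrite -mulmxBl.
rewrite (_ : `|_| = mx_norm ((x - y) *m M))// mx_normrE.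
apply/bigmax_leP; split=> [|[i j] _ /=]; first by rewrite !mulr_ge0.
rewrite mxE (ord1 i); apply: le_trans (ler_norm_sum _ _ _) _.
rewrite (_ : n%:R * _ * _ = \sum_(i < n) `|x - y| * `|M|); last first.
  by rewrite sumr_const card_ord -[RHS]mulr_natl -mulrA [`|M| * _]mulrC.
apply: ler_sum => k _; rewrite normrM ler_pM// ?ler_coord_norm//.
rewrite [leRHS](_ : _ = mx_norm M)// mx_normrE; apply/bigmax_geP; right.
by exists (k, j).
Qed.

Lemma continuous_dotv y : continuous (fun x => dotv x y).
Proof.
apply: (@lipschitz_continuous R^o _ (n%:R * `|y|)) => x z.
by rewrite -dotvNl -dotvDl -mulrA [`|y| * _]mulrC; exact: ler_dotv_norm.
Qed.

Lemma measurable_dotv y :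
  measurable_fun setT (fun x : borel_rV R n => dotv (x : 'rV[R]_n) y).
Proof. by apply: measurable_sum => i; apply: measurable_funM => //; exact: measurable_coord. Qed.

Lemma open_measurable_rV (U : set 'rV[R]_n) : open U -> measurable (U : set (borel_rV R n)).
Proof. exact: sub_sigma_algebra. Qed.

Lemma closed_measurable_rV (F : set 'rV[R]_n) : closed F -> measurable (F : set (borel_rV R n)).
Proof.
by move=> /closed_openC/open_measurable_rV/measurableC; rewrite setCK.
Qed.

Lemma closed_ge_fun (f g : 'rV[R]_n -> R) : continuous f -> continuous g ->
  closed [set x | f x <= g x].
Proof.
move=> cf cg; rewrite (_ : mkset _ = (fun x => g x - f x) @^-1` [set r | 0 <= r]).
  apply: closed_comp; last exact: closed_ge.
  by move=> x _; apply: continuousB; [exact: cg|exact: cf].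
by apply/seteqP; split => x /=; rewrite subr_ge0.
Qed.

End sphere_topology.

(** * Compactness of the sphere and elementary properties of convex bodies *)

Section sphere_bodies.
Context {R : realType} {d : nat}.
Local Notation V := 'rV[R]_d.+1.
Local Notation S := (@sphere R d).
Implicit Types (x y z : V) (K : set V).

Lemma sphere_neq0 x : S x -> x != 0.
Proof.
move=> /sphereE x1; apply/eqP => x0; move: x1; rewrite x0 dotv0r => /esym/eqP.
by rewrite oner_eq0.
Qed.

Lemma sphere_normalize x : x != 0 -> S (normalize x).
Proof.
move=> x0; rewrite /sphere/= enormZ ger0_norm ?invr_ge0 ?enorm_ge0// mulVf//.
apply: contra_neq x0 => e0; apply: dotv_eq0.
by rewrite -sqr_enorm e0 expr0n.
Qed.

Lemma enorm_gt0 x : x != 0 -> 0 < enorm x.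
Proof.
move=> /sphere_normalize; rewrite lt_neqAle enorm_ge0 andbT => Sx.
apply/eqP => e0; move: Sx; rewrite /sphere/= enormZ -e0 mulr0 => /esym/eqP.
by rewrite oner_eq0.
Qed.

Lemma normalizeE x : x = enorm x *: normalize x.
Proof.
have [->|/enorm_gt0 x0] := eqVneq x 0; first by rewrite /normalize !scaler0.
by rewrite /normalize scalerA divff ?scale1r// gt_eqF.
Qed.

Lemma continuous_dotvv : continuous (fun x : V => dotv x x).
Proof.
rewrite /dotv; elim: (index_enum _) => [|i s IHs].
  rewrite (_ : (fun x : V => _) = cst 0); first exact: cst_continuous.
  by apply/funext => x; rewrite big_nil.
pose f (x : V) := x ord0 i * x ord0 i.
pose g (x : V) := \sum_(j <- s) x ord0 j * x ord0 j.
rewrite (_ : (fun x : V => _) = f \+ g); last first.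
  by apply/funext => x; rewrite big_cons.
move=> x; apply: continuousD; last exact: IHs.
by apply: continuousM; exact: coord_continuous.
Qed.

Lemma closed_sphere : closed S.
Proof.
rewrite (_ : S = [set x | dotv x x <= 1] `&` [set x | 1 <= dotv x x]).
  by apply: closedI; apply: closed_ge_fun;
    do ?[exact: continuous_dotvv|exact: cst_continuous].
apply/seteqP; split => x /=; first by move/sphereE => ->.
by move=> [x1 x2]; apply/sphereE/eqP; rewrite eq_le x1.
Qed.

Lemma sqr_coord_le x i : (x ord0 i) ^+ 2 <= dotv x x.
Proof.
rewrite /dotv (bigD1 i)//= -expr2 lerDl; apply: sumr_ge0 => j _.
by rewrite -expr2 sqr_ge0.
Qed.

Lemma normr_le1 x : dotv x x <= 1 -> `|x| <= 1.
Proof.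
move=> x1; rewrite (_ : `|x| = mx_norm x)// mx_normrE; apply/bigmax_leP; split => // -[i j] _ /=.
rewrite (ord1 i) -(expr_le1 (n := 2))//= real_normK ?num_real//.
exact: le_trans (sqr_coord_le _ _) x1.
Qed.

Lemma sphere_norm_le1 x : S x -> `|x| <= 1.
Proof. by move=> /sphereE x1; apply: normr_le1; rewrite x1. Qed.

Lemma compact_sphere : compact S.
Proof.
apply: bounded_closed_compact; last exact: closed_sphere.
exists 1; split; first exact: num_real.
by move=> M M1 x /sphere_norm_le1/le_trans; apply; exact: ltW.
Qed.

Lemma sphere_dotvB x y : S x -> S y -> dotv x y = 1 - 2^-1 * dotv (x - y) (x - y).
Proof.
move=> /sphereE x1 /sphereE y1.
by rewrite dotvBr dotvDl dotvNl dotvDl dotvNl x1 y1 (dotvC y x); field.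
Qed.

Lemma sphere_dotv_itv x y : S x -> S y -> -1 <= dotv x y <= 1.
Proof.
move=> Sx Sy; apply/andP; split; last first.
  by rewrite sphere_dotvB// gerBl mulr_ge0 ?dotv_ge0.
rewrite -[y]opprK dotvNr lerN2 sphere_dotvB//; last exact: sphereN.
by rewrite gerBl mulr_ge0 ?dotv_ge0.
Qed.

Lemma sphere_net (r : R) : 0 < r ->
  exists s : seq V, (forall g, g \in s -> S g) /\
    forall y, S y -> exists2 g, g \in s & `|y - g| < r.
Proof.
move=> r0; have := compact_sphere; rewrite compact_cover.
move=> /(_ V S (fun g => ball g r))[].
- by move=> g _; exact: ball_open.
- by move=> y Sy; exists y => //; exact: ballxx.
- move=> D DS cD; exists (finmap.enum_fset D); split.
    by move=> g /DS; rewrite inE.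
  by move=> y /cD[g /= Dg]; rewrite -ball_normE/= distrC => gy; exists g.
Qed.

Lemma cone_scale (C : set V) (s : R) x : closed_convex_cone C -> 0 <= s -> C x -> C (s *: x).
Proof.
move=> [_ _ CC] s0 Cx; have := CC s 0 x x s0 (lexx _) Cx Cx.
by rewrite scale0r addr0.
Qed.

Lemma convex_bodies_sphere K : convex_bodies K -> K `<=` S.
Proof. by move=> [C [_ _ ->]] x []. Qed.

(** A cone that misses the sphere is reduced to 0, which is a linear subspace. *)
Lemma convex_bodies_nonempty K : convex_bodies K -> K !=set0.
Proof.
move=> [C [CC nC ->]]; apply: contrapT => C0; apply: nC.
have {}C0 x : C x -> x = 0.
  move=> Cx; apply: contrapT => /eqP x0; apply: C0; exists (normalize x).
  split; first exact: sphere_normalize.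
  by apply: cone_scale => //; rewrite invr_ge0 enorm_ge0.
case: CC => _ C00 _; split => // s t x y /C0 -> /C0 ->.
by rewrite !scaler0 addr0.
Qed.

Lemma convex_bodies_compact K : convex_bodies K -> compact K.
Proof.
move=> [C [[cC _ _] _ ->]]; apply: subclosed_compact compact_sphere _ => [|x []//].
exact: closedI closed_sphere cC.
Qed.

(** An intermediate value property: a nonnegative combination of [y] and [z] is orthogonal to [x],
    and it can be normalized unless [y] and [z] are antipodal. That the cone is not a subspace
    excludes the body consisting of [y] and [- y] alone. *)
Lemma convex_bodies_zero K x y z : convex_bodies K -> K y -> K z ->
  0 <= dotv x y -> dotv x z <= 0 -> exists2 w, K w & dotv x w = 0.
Proof.
move=> [C [CC nC ->]] [Sy Cy] [Sz Cz] xy xz.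
suff [w [Cw w0 xw]] : exists w, [/\ C w, w != 0 & dotv x w = 0].
  exists (normalize w); last by rewrite dotvZr xw mulr0.
  split; first exact: sphere_normalize.
  by apply: cone_scale => //; rewrite invr_ge0 enorm_ge0.
have [y0|y0] := eqVneq (dotv x y) 0; first by exists y; rewrite sphere_neq0.
have [z0|z0] := eqVneq (dotv x z) 0; first by exists z; rewrite sphere_neq0.
set b := dotv x y in xy y0; set a := dotv x z in xz z0.
have [CC0 C0 CCC] := CC.
have [w0|w0] := eqVneq (- a *: y + b *: z) 0; last first.
  exists (- a *: y + b *: z); split=> //; first by apply: CCC; rewrite ?oppr_ge0.
  by rewrite dotvDr !dotvZr -/a -/b; ring.
have b0 : 0 < b by rewrite lt_neqAle eq_sym y0.
have a0 : a < 0 by rewrite lt_neqAle z0.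
(* [z] is antipodal to [y]: use a third direction of the cone. *)
have zE : z = (a / b) *: y.
  apply/eqP; rewrite -subr_eq0 -scaleNr; apply/eqP.
  rewrite -[RHS](scaler0 V b^-1) -w0 scalerDr !scalerA mulVf ?gt_eqF// scale1r [RHS]addrC.
  by congr (_ + _ *: _); field; rewrite gt_eqF.
have CNy : C (- y).
  have -> : - y = (- (b / a)) *: z.
    rewrite zE scalerA -scaleN1r; congr (_ *: _); field.
    by rewrite (gt_eqF b0) (lt_eqF a0).
  apply: cone_scale => //; rewrite -mulrN mulr_ge0 ?ltW//.
  by rewrite oppr_gt0 invr_lt0.
(* A cone contained in the line of [y] and containing both [y] and [- y] would be that line, a
   linear subspace. *)
have [v Cv vy] : exists2 v, C v & forall t, v != t *: y.
  apply: contrapT => H; apply: nC; split => // s t v w Cv Cw.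
  have line u : C u -> exists t, u = t *: y.
    move=> Cu; apply: contrapT => Hu; apply: H; exists u => // r.
    by apply/eqP => ur; apply: Hu; exists r.
  have [[r ->] [r' ->]] := (line _ Cv, line _ Cw).
  rewrite !scalerA -scalerDl; have [r0|/ltW r0] := leP 0 (s * r + t * r').
    exact: cone_scale.
  rewrite -[X in C X]opprK -scaleNr -scalerN; apply: cone_scale => //.
  by rewrite oppr_ge0.
(* [v] is projected along [y] onto the hyperplane orthogonal to [x]; the cone allows this for either
   sign of the coefficient. *)
exists (v - (dotv x v / b) *: y); split.
- have [e0|/ltW e0] := leP 0 (dotv x v / b).
    by rewrite -scalerN -[v in C (v + _)]scale1r; apply: CCC.
  by rewrite -scaleNr -[v in C (v + _)]scale1r; apply: CCC => //; rewrite oppr_ge0.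
- by rewrite subr_eq0 vy.
- by rewrite dotvBr dotvZr -/b divfK ?subrr.
Qed.

End sphere_bodies.

(** * Support functions *)

Lemma measure_cover_le d (T : measurableType d) (R : realType)
    (m : {measure set T -> \bar R}) (I : eqType) (s : seq I) (A : I -> set T)
    (B : set T) (c : R) : measurable B -> (forall i, i \in s -> measurable (A i)) ->
  (forall x, B x -> exists2 i, i \in s & A i x) ->
  (forall i, i \in s -> m (A i) <= c%:E)%E -> (m B <= ((size s)%:R * c)%:E)%E.
Proof.
elim: s B => [|i s IHs] B mB mA BA Ac.
  rewrite (_ : B = set0) ?measure0 ?mul0r//.
  by apply/seteqP; split => // x /BA[].
have mAi : measurable (A i) by apply: mA; rewrite mem_head.
rewrite -(setUIDK B (A i)).
have mD := measurableD mB mAi; have mI := measurableI _ _ mB mAi.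
apply: le_trans (measureU2 _ mI mD) _.
rewrite /= -natr1 mulrDl mul1r EFinD [leRHS]addeC; apply: leeD.
  apply: (le_trans _ (Ac i (mem_head _ _))).
  by apply: le_measure; rewrite ?inE//; exact: subIsetr.
apply: IHs => //.
- by move=> j js; apply: mA; rewrite inE js orbT.
- move=> x [/BA[j + Ajx] Aix]; rewrite inE => /predU1P[ji|]; last by exists j.
  by rewrite ji in Ajx.
- by move=> j js; apply: Ac; rewrite inE js orbT.
Qed.

Section support_function.
Context {R : realType} {d : nat}.
Local Notation V := 'rV[R]_d.+1.
Local Notation S := (@sphere R d).
Implicit Types (x y z : V) (K : set V).

(** The properties of a body that enter the estimates of its support function; they pass to the
    reflected set, whose support function controls the minimum of [dotv x]. *)
Definition compact_part K := [/\ K !=set0, compact K & K `<=` S].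

Definition support K x : R := sup [set dotv x y | y in K].

(** The poles that have points of [K] on their nonnegative side, but none with margin [u]. *)
Definition support_shell K (u : R) : set V := [set x | 0 <= support K x < u].

Lemma convex_bodies_compact_part K : convex_bodies K -> compact_part K.
Proof.
move=> bK; split; first exact: convex_bodies_nonempty.
- exact: convex_bodies_compact.
- exact: convex_bodies_sphere.
Qed.

Lemma compact_part_opp K : compact_part K -> compact_part [set - y | y in K].
Proof.
move=> [[y Ky] cK KS]; split; first by exists (- y), y.
- apply: continuous_compact => //; apply: continuous_subspaceT.
  exact: opp_continuous.
- by move=> _ [z /KS Sz <-]; exact: sphereN.
Qed.

Lemma support_attained K x : compact_part K ->
  exists2 y, K y & support K x = dotv x y.
Proof.
move=> [K0 cK KS].
have [|y /set_mem Ky yM] := EVT_max_rV (f := fun y => dotv x y) K0 cK.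
  apply: continuous_subspaceT; under eq_fun do rewrite dotvC.
  exact: continuous_dotv.
exists y => //; apply/eqP; rewrite eq_le; apply/andP; split.
  apply: sup_le_ub; first by exists (dotv x y), y.
  by move=> _ [z Kz <-]; apply: yM; rewrite inE.
apply: ub_le_sup; last by exists y.
by exists (dotv x y) => _ [z Kz <-]; apply: yM; rewrite inE.
Qed.

Lemma support_ge K x y : compact_part K -> K y -> dotv x y <= support K x.
Proof.
move=> [K0 cK KS] Ky; apply: ub_le_sup; last by exists y.
exists (d.+1%:R * `|x|) => _ [z /KS/sphere_norm_le1 z1 <-].
apply: le_trans (ler_norm _) _; apply: le_trans (ler_dotv_norm _ _) _.
by rewrite ler_wpM2l// ler_piMr.
Qed.

Lemma support_le K x z : compact_part K ->
  support K x <= support K z + d.+1%:R * `|x - z|.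
Proof.
move=> cK; have [y Ky ->] := support_attained x cK.
rewrite -lerBlDl; apply: (@le_trans _ _ (dotv (x - z) y)).
  by rewrite dotvDl dotvNl lerB// support_ge.
apply: le_trans (ler_norm _) _; apply: le_trans (ler_dotv_norm _ _) _.
rewrite ler_wpM2l// ler_piMr// sphere_norm_le1//.
by case: cK => _ _; exact.
Qed.

Lemma support_dist K x z : compact_part K ->
  `|support K x - support K z| <= d.+1%:R * `|x - z|.
Proof.
move=> cK; rewrite ler_distl lerBlDr; apply/andP; split; last exact: support_le.
by rewrite distrC; exact: support_le.
Qed.

Lemma continuous_support K : compact_part K -> continuous (support K).
Proof.
by move=> cK; apply: (@lipschitz_continuous _ _ R^o _ d.+1%:R) => x z; exact: support_dist.
Qed.

(* The direction of a large coordinate of the maximizer of [dotv z] on [K]. *)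
Lemma support_slope K z : compact_part K ->
  exists (i : 'I_d.+1) (b : bool), forall t, 0 <= t ->
    support K z + t / d.+1%:R <= support K (z + (t * (-1) ^+ b) *: delta_mx ord0 i).
Proof.
move=> cK; have [y Ky zy] := support_attained z cK.
(* Otherwise every coordinate, and so every squared coordinate, is below [d.+1%:R^-1], and the unit
   vector [y] has squared norm below 1. *)
have [i yi] : exists i, d.+1%:R^-1 <= `|y ord0 i|.
  apply: contrapT => /forallNP yi.
  have /sphereE y1 : S y by case: cK => _ _; exact.
  suff : dotv y y < 1 by rewrite y1 ltxx.
  apply: (@lt_le_trans _ _ (\sum_(i < d.+1) d.+1%:R^-1)); last first.
    by rewrite sumr_const card_ord -[_ *+ _]mulr_natr mulVf.
  apply: ltr_sum => [|i _]; first by apply/hasP; exists ord0 => //; exact: mem_index_enum.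
  have := yi i; move/negP; rewrite -ltNge => {}yi.
  have yi1 : `|y ord0 i| <= 1 by rewrite (le_trans (ltW yi))// invf_le1// ler1n.
  apply: le_lt_trans yi; rewrite -expr2 -real_normK ?num_real// expr2.
  by rewrite ler_piMr.
(* The sign makes the displacement add [t] times the absolute value of [y ord0 i] to the scalar
   product with [y], which still bounds the support function from below. *)
exists i, (y ord0 i < 0) => t t0.
apply: (@le_trans _ _ (dotv (z + (t * (-1) ^+ (y ord0 i < 0)%R) *: delta_mx ord0 i) y)); last first.
  exact: support_ge.
rewrite dotvDl dotvZl -zy lerD2l -mulrA ler_wpM2l//.
suff -> : dotv (delta_mx ord0 i) y = y ord0 i by rewrite -normrEsign.
rewrite /dotv (bigD1 i)//= big1 ?addr0 => [|j ji]; rewrite mxE eqxx/= ?eqxx ?mul1r//.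
by rewrite (negbTE ji) mul0r.
Qed.

Lemma open_lt_fun (f : V -> R) u : continuous f -> open [set x | f x < u].
Proof.
move=> cf; rewrite (_ : mkset _ = ~` [set x | u <= f x]).
  by apply: closed_openC; apply: closed_ge_fun => // x; exact: cst_continuous.
by apply/seteqP; split => x /=; rewrite ltNge => /negP.
Qed.

Lemma punctured_ball_unit_box : @punctured_ball R d `<=` @unit_box R d.+1.
Proof.
move=> x [/andP[_ x1]] i; rewrite -ler_norml.
apply: le_trans (ler_coord_norm _ _) _; apply: normr_le1.
by rewrite -sqr_enorm expr_le1// enorm_ge0.
Qed.

Lemma measurable_support_shell K (u : R) : compact_part K ->
  measurable (support_shell K u : set (borel_rV R d.+1)).
Proof.
move=> /continuous_support cs.
rewrite (_ : support_shell K u = [set z | 0 <= support K z] `&` [set z | support K z < u]).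
  apply: measurableI; last by apply: open_measurable_rV; exact: open_lt_fun.
  by apply: closed_measurable_rV; apply: closed_ge_fun => //; exact: cst_continuous.
by apply/seteqP; split => z /= => [/andP[]|[? ?]]; last exact/andP.
Qed.

(** The box is covered by [2 * d.+1] pieces, one for each signed axis along which the support
    function is steep; each piece is thin in the direction of its axis. *)
Lemma support_shell_lebesgue K (u : R) : compact_part K -> 0 <= u ->
  (lebesgue_rV (support_shell K u `&` @unit_box R d.+1 : set (borel_rV R d.+1)) <=
   ((2 * d.+1%:R) * (2 ^+ d.+1 * (u * d.+1%:R)))%:E)%E.
Proof.
move=> cK u0; set B := _ `&` _.
have cs := continuous_support cK.
have mB : measurable (B : set (borel_rV R d.+1)).
  apply: measurableI; last exact: measurable_unit_box.
  exact: measurable_support_shell.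
pose steep (ib : 'I_d.+1 * bool) := [set z | forall t, 0 <= t ->
  support K z + t / d.+1%:R <= support K (z + (t * (-1) ^+ ib.2) *: delta_mx ord0 ib.1)].
have msteep ib : measurable (steep ib : set (borel_rV R d.+1)).
  apply: closed_measurable_rV.
  rewrite (_ : steep ib = \bigcap_(t in [set t | 0 <= t])
      [set z | support K z + t / d.+1%:R <= support K (z + (t * (-1) ^+ ib.2) *: delta_mx ord0 ib.1)])//.
  apply: closed_bigI => t _.
  apply: closed_ge_fun.
    by move=> x; apply: continuousD; [exact: cs|exact: cst_continuous].
  apply: (@lipschitz_continuous _ _ R^o _ d.+1%:R) => x y.
  by apply: le_trans (support_dist _ _ cK) _; rewrite opprD addrACA subrr addr0.
rewrite (_ : 2 * _ = (size (enum {: 'I_d.+1 * bool}))%:R); last first.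
  by rewrite -cardE card_prod card_ord card_bool mulrC natrM.
apply: (@measure_cover_le _ _ R (@lebesgue_rV R d.+1) ('I_d.+1 * bool)%type _ (fun ib => B `&` steep ib : set (borel_rV R d.+1)) B) => //.
- by move=> ib _; exact: measurableI.
- move=> z Bz; have [i [b ib]] := support_slope z cK.
  by exists (i, b); rewrite ?mem_enum.
- move=> [i b] _; apply: (@lebesgue_rV_thin _ _ i).
  + exact: measurableI.
  + by move=> z [[]].
  + by rewrite mulr_ge0.
  + move=> v w [[/= /andP[v0 vu] _] vs] [[/= /andP[w0 wu] _] ws] vw.
    have shift (x y : V) : (forall j, j != i -> x ord0 j = y ord0 j) ->
        y = x + ((y ord0 i - x ord0 i) * (-1) ^+ b * (-1) ^+ b) *: delta_mx ord0 i.
      move=> xy; apply/rowP => j; rewrite !mxE eqxx/=.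
      rewrite -[_ * (-1) ^+ b]mulrA -expr2 sqrr_sign mulr1.
      by have [->|/xy ->] := eqVneq j i; [rewrite mulr1 addrC subrK|rewrite mulr0 addr0].
    (* Along the steep direction the support function grows at rate at least [d.+1%:R^-1], from a
       nonnegative value to one below [u]. *)
    have key (x y : V) : 0 <= support K x -> support K y < u -> steep (i, b) x ->
        (forall j, j != i -> x ord0 j = y ord0 j) ->
        0 <= (y ord0 i - x ord0 i) * (-1) ^+ b ->
        (y ord0 i - x ord0 i) * (-1) ^+ b <= u * d.+1%:R.
      move=> x0 yu xs /shift yE t0; have := xs _ t0; rewrite -yE => H.
      rewrite -ler_pdivrMr// (le_trans _ (ltW yu))// (le_trans _ H)// lerDr//.
    (* Whichever of [v] and [w] comes first in the steep direction serves as the base point. *)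
    have [t0|/ltW t0] := leP 0 ((w ord0 i - v ord0 i) * (-1) ^+ b).
      by rewrite distrC -(normrMsign b) mulrC ger0_norm//; exact: (key v w).
    rewrite -(normrMsign b) mulrC ger0_norm; last first.
      by rewrite -opprB mulNr oppr_ge0.
    apply: (key w v) => //.
      by move=> j /vw ->.
    by rewrite -opprB mulNr oppr_ge0.
Qed.

End support_function.

(** * The measure of the hyperspheres hitting a body *)

Section hitting_functional.
Context {R : realType} {d : nat}.
Local Notation V := 'rV[R]_d.+1.
Local Notation S := (@sphere R d).
Local Notation sigma := (@sphere_measure R d).
Implicit Types (x y z : V) (K : set V).

Local Notation total := (cone_measure [set: borel_rV R d.+1]).

Lemma cone_measure_lty : (total < +oo)%E.
Proof.
rewrite /cone_measure preimage_setT setTI.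
apply: (@le_lt_trans _ _ (lebesgue_rV (@unit_box R d.+1))); last first.
  by apply: le_lt_trans (lebesgue_rV_unit_box _) _; exact: ltry.
apply: le_measure; rewrite ?inE.
- exact: measurable_punctured_ball.
- exact: measurable_unit_box.
- exact: punctured_ball_unit_box.
Qed.

Lemma sphere_measure_fin_num (A : set (borel_rV R d.+1)) : measurable A ->
  sigma A \is a fin_num.
Proof.
move=> mA; rewrite ge0_fin_numE// sphere_measureE.
apply: (@le_lt_trans _ _ ((fine total)^-1%:E * total)%E).
  apply: lee_wpmul2l; first by rewrite lee_fin invr_ge0 fine_ge0.
  by apply: le_measure; rewrite ?inE.
have /fineK <- : total \is a fin_num by rewrite ge0_fin_numE// cone_measure_lty.
exact: ltry.
Qed.

Lemma support_normalize K x : compact_part K -> x != 0 ->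
  support K x = enorm x * support K (normalize x).
Proof.
move=> cK x0; have e0 := enorm_gt0 x0; apply/eqP; rewrite eq_le; apply/andP; split.
  have [y Ky ->] := support_attained x cK.
  by rewrite {1}(normalizeE x) dotvZl ler_pM2l// support_ge.
have [y Ky ->] := support_attained (normalize x) cK.
by rewrite -dotvZl -normalizeE support_ge.
Qed.

(** The constant does not depend on [K]. The support function is positively homogeneous, so the
    shell over the sphere, extended radially into the unit ball, remains in the shell. *)
Lemma support_shell_sphere : exists2 C : R, 0 <= C &
  forall K u, compact_part K -> 0 <= u ->
    (sigma (support_shell K u) <= (C * u)%:E)%E.
Proof.
pose c : R := (2 * d.+1%:R) * (2 ^+ d.+1 * d.+1%:R).
exists ((fine total)^-1 * c).
  by rewrite mulr_ge0 ?invr_ge0 ?fine_ge0// /c !mulr_ge0.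
move=> K u cK u0; rewrite sphere_measureE -mulrA EFinM.
apply: lee_wpmul2l; first by rewrite lee_fin invr_ge0 fine_ge0.
apply: (@le_trans _ _ (lebesgue_rV (support_shell K u `&` @unit_box R d.+1 : set (borel_rV R d.+1)))); last first.
  apply: le_trans (support_shell_lebesgue cK u0) _.
  by rewrite lee_fin /c le_eqVlt; apply/orP; left; apply/eqP; ring.
have mS := measurable_support_shell u cK.
rewrite /cone_measure; apply: le_measure; rewrite ?inE.
- apply: measurableI; last exact: measurable_punctured_ball.
  exact: (measurable_preimage (@measurable_normalize R d)).
- by apply: measurableI => //; exact: measurable_unit_box.
- move=> x [/= /andP[x0 xu] Bx]; split; last exact: punctured_ball_unit_box.
  have /andP[e0 e1] := Bx.
  have x00 : x != 0.
    by apply/eqP => x00; move: e0; rewrite x00 /enorm dotv0r sqrtr0 ltxx.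
  rewrite /support_shell/= (support_normalize cK x00) mulr_ge0 ?(ltW e0)//=.
  by apply: le_lt_trans xu; rewrite ler_piMl.
Qed.

Definition hitting K : set (borel_rV R d.+1) :=
  [set x | S x /\ great_hypersphere x `&` K !=set0].

(** By [convex_bodies_zero], a hypersphere meets the body once [dotv x] has a nonnegative maximum
    and a nonpositive minimum on it; this makes the hitting set closed. *)
Lemma hitting_support K : convex_bodies K ->
  hitting K = S `&` [set x | 0 <= support K x] `&` [set x | 0 <= support [set - y | y in K] x].
Proof.
move=> bK; have cK := convex_bodies_compact_part bK; have cNK := compact_part_opp cK.
apply/seteqP; split => [x [Sx [y [[_ xy] Ky]]]|x [[Sx /= x1] x2]].
  split; [split=> //=|rewrite /=].
    by rewrite -xy support_ge.
  by rewrite -[leLHS]oppr0 -xy -dotvNr support_ge//; exists y.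
split => //; have [y Ky xy] := support_attained x cK.
have [_ [z Kz <-] xz] := support_attained x cNK.
rewrite xy in x1; rewrite xz dotvNr oppr_ge0 in x2.
have [w Kw xw] := convex_bodies_zero bK Ky Kz x1 x2.
by exists w; do 2?split => //; exact: convex_bodies_sphere Kw.
Qed.

Lemma measurable_sphere : measurable (S : set (borel_rV R d.+1)).
Proof. exact: closed_measurable_rV closed_sphere. Qed.

Lemma measurable_hitting K : convex_bodies K -> measurable (hitting K).
Proof.
move=> bK; have cK := convex_bodies_compact_part bK; have cNK := compact_part_opp cK.
rewrite hitting_support//; apply: measurableI; first apply: measurableI.
- exact: measurable_sphere.
- apply: closed_measurable_rV; apply: closed_ge_fun; first exact: cst_continuous.
  exact: continuous_support.
- apply: closed_measurable_rV; apply: closed_ge_fun; first exact: cst_continuous.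
  exact: continuous_support.
Qed.

Lemma Phi2U1E K : convex_bodies K -> Phi2U1 K = fine (sigma (hitting K)).
Proof.
move=> bK; rewrite /Phi2U1 /U1 mulrA divff ?mul1r// /Rintegral; congr fine.
have -> : hitting K = hitting K `&` S by apply/seteqP; split => x [].
rewrite -integral_indic; [|exact: measurable_sphere|exact: measurable_hitting].
apply: eq_integral => x; rewrite inE => Sx; congr EFin; rewrite !indicE; congr (_%:R).
congr nat_of_bool; apply/idP/idP; rewrite !inE /hitting/=; first by split.
by case.
Qed.

Lemma Phi2U1_ge0 K : convex_bodies K -> 0 <= Phi2U1 K.
Proof. by move=> bK; rewrite Phi2U1E// fine_ge0. Qed.

Lemma Phi2U1_rotation K (M : 'M[R]_d.+1) : convex_bodies K ->
  convex_bodies [set x *m M | x in K] -> preserving_rotation M ->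
  Phi2U1 [set x *m M | x in K] = Phi2U1 K.
Proof.
move=> bK bM pM; rewrite !Phi2U1E//; congr fine.
rewrite -(sphere_measure_rotation pM); last exact: measurable_hitting.
have [[MM _] _] := pM; congr sigma; apply/seteqP; split => x.
  move=> [/(sphere_mulmx _ MM) Sx [w [[_ xy] [y Ky yM]]]]; split; first exact: Sx.
  exists y; split => //; split; first exact: convex_bodies_sphere Ky.
  by rewrite -(dotv_mulmx _ _ MM) yM.
move=> [Sx [y [[Sy xy] Ky]]]; split; first exact/(sphere_mulmx _ MM).
exists (y *m M); split; last by exists y.
by split; [exact/(sphere_mulmx _ MM)|rewrite dotv_mulmx].
Qed.

Lemma convex_bodies_rotation K (M : 'M[R]_d.+1) : convex_bodies K -> rotation M ->
  convex_bodies [set x *m M | x in K].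
Proof.
move=> [C [[cC C0 CC] nC ->]] rM; have [MM _] := rM; have MM' := rotation_tr rM.
have MK x : x *m M^T *m M = x by rewrite -mulmxA MM' mulmx1.
have KM x : x *m M *m M^T = x by rewrite -mulmxA MM mulmx1.
exists [set x | C (x *m M^T)]; split.
- split; last 2 first.
  + by rewrite /= mul0mx.
  + by move=> s t x y s0 t0 Cx Cy; rewrite /= mulmxDl -!scalemxAl; exact: CC.
  + rewrite (_ : mkset _ = (fun x => x *m M^T) @^-1` C)//; apply: closed_comp => // x _.
    exact: mulmx_continuous.
- move=> [_ lC]; apply: nC; split => // s t x y Cx Cy.
  have := lC s t (x *m M) (y *m M).
  by rewrite /= !KM mulmxDl -!scalemxAl !KM; exact.
- apply/seteqP; split => [_ [x [Sx Cx] <-]|x [Sx Cx]].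
    by split; [exact/(sphere_mulmx _ MM)|rewrite /= KM].
  exists (x *m M^T); last exact: MK.
  by split => //; apply/(sphere_mulmx _ MM); rewrite MK.
Qed.

(** The finite record of a body: being a filter of [s], it is given by one of finitely many masks of
    [s]. *)
Definition near_net (r : R) (s : seq V) K : seq V :=
  [seq g <- s | `[< exists2 y, K y & `|y - g| < r >]].

(* The margin ensures that such a hypersphere separates two points of every [K] having the
   points of [G] within distance [r]. *)
Definition separating (r : R) (G : seq V) : set (borel_rV R d.+1) :=
  [set x | S x /\ exists g g', [/\ g \in G, g' \in G,
     d.+1%:R * r <= dotv x g & dotv x g' <= - (d.+1%:R * r)]].

Lemma measurable_separating r G : measurable (separating r G).
Proof.
rewrite (_ : separating r G = S `&` \bigcup_(gg in [set gg : V * V | gg.1 \in G /\ gg.2 \in G])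
   ([set x : V | d.+1%:R * r <= dotv x gg.1] `&` [set x : V | dotv x gg.2 <= - (d.+1%:R * r)])).
  apply: measurableI; first exact: measurable_sphere.
  apply: fin_bigcup_measurable.
    apply: (@sub_finite_set _ _ ([set` G] `*` [set` G])); first by move=> [].
    by apply: finite_setX; exact: finite_seq.
  move=> gg _; apply: measurableI; apply: closed_measurable_rV; apply: closed_ge_fun;
    by [exact: cst_continuous|exact: continuous_dotv].
apply/seteqP; split => x.
  move=> [Sx [g [g' [Gg Gg' xg xg']]]]; split => //.
  by exists (g, g').
by move=> [Sx [[g g'] [/= Gg Gg'] [xg xg']]]; split => //; exists g, g'.
Qed.

Lemma separating_near_net r s K x : separating r (near_net r s K) x ->
  exists y z, [/\ K y, K z, 0 < dotv x y & dotv x z < 0].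
Proof.
move=> [Sx [g [g' []]]]; rewrite !mem_filter => /andP[/asboolP[y Ky yg] _].
move=> /andP[/asboolP[z Kz zg] _] xg xg'; exists y, z; split => //.
  have : dotv x (g - y) < d.+1%:R * r.
    apply: le_lt_trans (ler_norm _) _; apply: le_lt_trans (ler_dotv_norm _ _) _.
    rewrite ltr_pM2l//; apply: le_lt_trans yg; rewrite distrC ler_piMl//.
    exact: sphere_norm_le1.
  by rewrite dotvBr; lra.
have : dotv x (z - g') < d.+1%:R * r.
  apply: le_lt_trans (ler_norm _) _; apply: le_lt_trans (ler_dotv_norm _ _) _.
  rewrite ltr_pM2l//; apply: le_lt_trans zg; rewrite ler_piMl//.
  exact: sphere_norm_le1.
by rewrite dotvBr; lra.
Qed.

(** A pole that hits [K] and lies outside the shells of [K] and of its reflection is separating;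
    each of the two shells contributes a multiple of its width to the loss. *)
Lemma separating_measure_ge : exists2 C : R, 0 <= C &
  forall (r : R) s K, 0 < r -> (forall y, S y -> exists2 g, g \in s & `|y - g| < r) ->
    convex_bodies K -> Phi2U1 K - C * r <= fine (sigma (separating r (near_net r s K))).
Proof.
have [C C0 CP] := support_shell_sphere.
exists (C * (2 * d.+1%:R) + C * (2 * d.+1%:R)).
  by rewrite addr_ge0// mulr_ge0.
move=> r s K r0 sP bK.
have cK := convex_bodies_compact_part bK; have cNK := compact_part_opp cK.
(* Half of the width is lost in passing from a point of [K] to a net point; the other half is the
   margin required in [separating]. *)
pose u := 2 * d.+1%:R * r; have u0 : 0 <= u by rewrite /u !mulr_ge0// ltW.
set T := separating _ _; have mT : measurable T by exact: measurable_separating.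
have m1 := measurable_support_shell u cK; have m2 := measurable_support_shell u cNK.
have near y x : K y -> S x -> exists2 g, g \in near_net r s K & `|dotv x (y - g)| <= d.+1%:R * r.
  move=> Ky Sx; have [g gs yg] := sP y (convex_bodies_sphere bK Ky).
  exists g; first by rewrite mem_filter gs andbT; apply/asboolP; exists y.
  apply: le_trans (ler_dotv_norm _ _) _; rewrite ler_pM2l//.
  apply: le_trans (ltW yg); rewrite ler_piMl//; exact: sphere_norm_le1.
have sub : hitting K `<=` T `|` (support_shell K u `|` support_shell [set - y | y in K] u).
  rewrite hitting_support// => x [[Sx /= x1] x2].
  have [xu|xu] := ltP (support K x) u; first by right; left; apply/andP.
  have [yu|yu] := ltP (support [set - y | y in K] x) u; first by right; right; apply/andP.
  left; split => //.
  have [y Ky xy] := support_attained x cK.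
  have [_ [z Kz <-] xz] := support_attained x cNK.
  rewrite xy in xu; rewrite xz dotvNr in yu.
  have [g Gg] := near _ _ Ky Sx; rewrite dotvBr => /ler_normlP[_ yg].
  have [g' Gg'] := near _ _ Kz Sx; rewrite dotvBr => /ler_normlP[zg _].
  exists g, g'; split => //; move: xu yu yg zg; rewrite /u -mulrA;
    move: (d.+1%:R * r) => ?; lra.
have : (sigma (hitting K) <= sigma T + ((C * u)%:E + (C * u)%:E))%E.
  apply: (@le_trans _ _ (sigma (T `|` (support_shell K u `|` support_shell [set - y | y in K] u)))).
    apply: le_measure; rewrite ?inE//; first exact: measurable_hitting.
    by apply: measurableU => //; exact: measurableU.
  apply: le_trans (measureU2 _ mT (measurableU _ _ m1 m2)) _; apply: leeD => //.
  by apply: le_trans (measureU2 _ m1 m2) _; apply: leeD; exact: CP.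
rewrite Phi2U1E// -(fineK (sphere_measure_fin_num mT)).
rewrite -(fineK (sphere_measure_fin_num (measurable_hitting bK))) -!EFinD lee_fin.
by rewrite /= /u; lra.
Qed.

End hitting_functional.

(** * The cells of a hypersphere tessellation *)

Section crofton_cells.
Context {R : realType} {d : nat}.
Local Notation V := 'rV[R]_d.+1.
Local Notation S := (@sphere R d).
Implicit Types (x y z p q : V) (s : seq V).

Lemma continuous_normalize x : x != 0 -> {for x, continuous (@normalize R d : V -> V)}.
Proof.
move=> x0; have e0 := enorm_gt0 x0.
apply: (continuousZ (s := fun y : V => (enorm y)^-1) (f := fun y : V => y)); last first.
  exact: cvg_id.
apply: continuousV; first by rewrite gt_eqF.
apply: (@continuous_comp _ _ _ (fun y : V => dotv y y) Num.sqrt); last exact: sqrt_continuous.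
exact: continuous_dotvv.
Qed.

Lemma continuous_line y v : continuous (fun t : R => y + t *: v : V).
Proof.
move=> t; apply: (continuousD (f := fun=> y) (g := fun t : R => t *: v)).
  exact: cst_continuous.
by apply: continuousZr_tmp; exact: cvg_id.
Qed.

Lemma dotv_normalize x y : dotv x (normalize y) = (enorm y)^-1 * dotv x y.
Proof. exact: dotvZr. Qed.

(** A short displacement of [p], projected back to the sphere, stays in a given neighbourhood. The
    bound [t < 1] keeps the point on the segment when [v] is the difference to another point. *)
Lemma sphere_line_near p v (B : set V) : S p -> nbhs p B ->
  exists t : R, [/\ 0 < t, t < 1, p + t *: v != 0 & B (normalize (p + t *: v))].
Proof.
move=> Sp nB; have p0 := sphere_neq0 Sp.
have np : normalize p = p by rewrite /normalize Sp invr1 scale1r.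
have : nbhs (0 : R) [set t : R | p + t *: v != 0 /\ B (normalize (p + t *: v))].
  have cl : (fun t : R => p + t *: v : V) t @[t --> (0 : R)] --> p.
    by have := @continuous_line p v 0; rewrite /continuous_at scale0r addr0.
  have cn : (normalize x : V) @[x --> p] --> p.
    by rewrite -[X in _ --> X]np; exact: continuous_normalize.
  apply: (@filterI _ (nbhs (0 : R))).
    apply: (cl [set w : V | w != 0]).
    apply: open_nbhs_nbhs; split => //.
    rewrite (_ : mkset _ = ~` [set 0]); last by apply/seteqP; split => w /= /eqP.
    apply: closed_openC; apply: (compact_closed (@norm_hausdorff R V)); exact: compact_set1.
  exact: (cl _ (cn _ nB)).
move=> /nbhs_ballP[r /= r0 rB].
pose t := Num.min (r / 2) 2^-1.
have t0 : 0 < t by rewrite lt_min invr_gt0 divr_gt0/=.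
have tr : t < r by rewrite gt_min ltr_pdivrMr// ltr_pMr// ltr1n.
have t1 : t < 1 by rewrite gt_min invf_lt1// ltr1n orbT.
by exists t; have [] := rB t _; rewrite // -ball_normE/= sub0r normrN gtr0_norm.
Qed.

(** Pairing a vanishing combination with [y] and with [z] gives a linear system that forces [t = 0]
    or [dotv y z] equal to 1 or -1; only the antipodal case avoids a contradiction. *)
Lemma segment_neq0 y z t : S y -> S z -> z != - y -> y + t *: (z - y) != 0.
Proof.
move=> /sphereE y1 /sphereE z1 zy; apply/eqP => w0.
have e1 : (1 - t) + t * dotv y z = 0.
  by rewrite -(dotv0r y) -w0 dotvDr dotvZr dotvBr y1; ring.
have e2 : (1 - t) * dotv y z + t = 0.
  by rewrite -(dotv0r z) -w0 dotvDr dotvZr dotvBr z1 (dotvC z); ring.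
have : (1 - dotv y z ^+ 2) * t = 0.
  transitivity ((1 - t) * dotv y z + t - dotv y z * (1 - t + t * dotv y z)); first by ring.
  by rewrite e1 e2 mulr0 subr0.
move/eqP; rewrite mulf_eq0 => /orP[|/eqP t0]; last first.
  by move/eqP: e1; rewrite t0 mul0r subr0 addr0 oner_eq0.
rewrite subr_eq0 eq_sym sqrf_eq1 => /orP[|] /eqP yz.
  by move/eqP: e1; rewrite yz mulr1 subrK oner_eq0.
suff : z + y == 0 by rewrite addr_eq0 (negbTE zy).
by apply/eqP/dotv_eq0; rewrite dotvDl !dotvDr y1 z1 (dotvC z) yz; ring.
Qed.

Lemma segment_component (D : set V) y z : S y -> S z -> z != - y ->
  (forall t, 0 <= t <= 1 -> D (normalize (y + t *: (z - y)))) ->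
  connected_component D y z.
Proof.
move=> Sy Sz zy tD; exists ((fun t : R => normalize (y + t *: (z - y)) : V) @` `[0, 1]).
  split.
  - exists 0; first by rewrite /= in_itv/= lexx ler01.
    by rewrite scale0r addr0 /normalize Sy invr1 scale1r.
  - by move=> _ [t t01 <-]; apply: tD; move: t01; rewrite /= in_itv.
  - apply: connected_continuous_connected; first exact: segment_connected.
    apply: continuous_in_subspaceT => t _.
    apply: (@continuous_comp _ _ _ (fun t : R => y + t *: (z - y) : V) (@normalize R d)).
      exact: continuous_line.
    by apply: continuous_normalize; exact: segment_neq0.
exists 1; first by rewrite /= in_itv/= lexx ler01.
by rewrite scale1r addrC subrK /normalize Sz invr1 scale1r.
Qed.

(** Positivity of the product says that [y] and [q] lie strictly on the same side of the hypersphere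
    of [x], whichever side that is. *)
Definition open_cell s q : set V :=
  [set y | S y /\ forall x, x \in s -> 0 < dotv x q * dotv x y].

Definition closed_cell s q : set V :=
  [set y | S y /\ forall x, x \in s -> 0 <= dotv x q * dotv x y].

Definition off_hyperspheres s q := forall x, x \in s -> dotv x q != 0.

Lemma off_hyperspheresP s q :
  (S `\` \bigcup_(x in [set` s]) great_hypersphere x) q <-> S q /\ off_hyperspheres s q.
Proof.
split=> [[Sq nq]|[Sq nq]]; split => //.
  by move=> x xs; apply/eqP => xq; apply: nq; exists x.
by move=> [x /= xs [_ /eqP]]; rewrite (negbTE (nq x xs)).
Qed.

Lemma open_cell_line s p q t : closed_cell s q p -> off_hyperspheres s q -> 0 < t -> t <= 1 ->
  p + t *: (q - p) != 0 -> open_cell s q (normalize (p + t *: (q - p))).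
Proof.
move=> [Sp qp] nq t0 t1 w0; split; first exact: sphere_normalize.
move=> x xs; rewrite dotv_normalize mulrCA pmulr_rgt0 ?invr_gt0 ?enorm_gt0//.
rewrite dotvDr dotvZr dotvBr.
rewrite (_ : _ * _ = (1 - t) * (dotv x q * dotv x p) + t * dotv x q ^+ 2); last by ring.
apply: ltr_wpDl; first by rewrite mulr_ge0 ?subr_ge0// qp.
by rewrite mulr_gt0// exprn_even_gt0//= nq.
Qed.

(** The scalar product with a pole keeps its sign on a connected set that avoids the hypersphere;
    conversely, points on the same sides are joined by a projected segment. *)
Lemma connected_component_open_cell s q (e : V) : S e -> e != q -> e != - q ->
  S q -> off_hyperspheres s q ->
  connected_component (S `\` \bigcup_(x in [set` s]) great_hypersphere x) q = open_cell s q.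
Proof.
move=> Se eq eNq Sq nq; set D := S `\` _.
have cellD y : open_cell s q y -> D y.
  move=> [Sy ys]; apply/off_hyperspheresP; split => // x /ys; rewrite lt_neqAle eq_sym.
  by rewrite mulf_eq0 negb_or => /andP[/andP[]].
apply/seteqP; split => [y qy|y cy].
  have [Sy ny] : S y /\ off_hyperspheres s y by apply/off_hyperspheresP; exact: connected_component_sub qy.
  split => // x xs; have xq := nq x xs; have xy := ny x xs.
  rewrite lt_neqAle eq_sym mulf_neq0//= leNgt; apply/negP => qy0.
  have : connected ((fun z => dotv z x) @` connected_component D q).
    apply: connected_continuous_connected; first exact: component_connected.
    by apply: continuous_subspaceT; exact: continuous_dotv.
  move=> /connected_intervalP.
  have Iq : ((fun z => dotv z x) @` connected_component D q) (dotv x q).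
    exists q; last exact: dotvC.
    by apply: connected_component_refl; apply/off_hyperspheresP.
  have Iy : ((fun z => dotv z x) @` connected_component D q) (dotv x y).
    by exists y => //; exact: dotvC.
  suff zero I : is_interval I -> I (dotv x q) -> I (dotv x y) -> I (0 : R).
    move=> /zero /(_ Iq Iy)[z /connected_component_sub/off_hyperspheresP[_ /(_ _ xs)]].
    by rewrite dotvC => /eqP.
  move=> iI I1 I2; have [x0|x0] := ltP 0 (dotv x q).
    by apply: (iI _ _ I2 I1); rewrite ltW//= ?ltW//; move: qy0; rewrite pmulr_rlt0// => /ltW.
  have {}x0 : dotv x q < 0 by rewrite lt_neqAle xq.
  apply: (iI _ _ I1 I2); rewrite (ltW x0)/=.
  by move: qy0; rewrite nmulr_rlt0// => /ltW.
have clos z : open_cell s q z -> closed_cell s q z.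
  by move=> [Sz zs]; split => // x /zs/ltW.
have [yq|yq] := eqVneq y (- q); last first.
  apply: connected_component_sym; apply: segment_component => //.
  - by case: cy.
  - by apply: contra_neq yq => ->; rewrite opprK.
  move=> t /andP[]; rewrite le_eqVlt => /predU1P[<- _|t0 t1].
    rewrite scale0r addr0 /normalize; case: cy (cy) => [-> _] cy.
    by rewrite invr1 scale1r; exact: cellD.
  apply/cellD/open_cell_line => //; first exact: clos.
  apply: segment_neq0 => //; first by case: cy.
  by apply: contra_neq yq => ->; rewrite opprK.
(* Antipodal points share an open cell only if there is no hypersphere at all; they are then joined
   through the third point [e]. *)
have s0 : s = [::].
  case: s cy nq {D cellD clos} => // x s [_ /(_ x (mem_head _ _)) +] _.
  by rewrite yq dotvNr mulrN oppr_gt0 -expr2 ltNge sqr_ge0.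
have SD z : S z -> D z by move=> Sz; apply/off_hyperspheresP; split => // x; rewrite s0.
apply: (@connected_component_trans _ _ e); apply: segment_component => //.
- move=> t _; apply/SD/sphere_normalize/segment_neq0 => //.
- by case: cy.
- by rewrite yq eqr_opp eq_sym.
- move=> t _; apply/SD/sphere_normalize/segment_neq0 => //; first by case: cy.
  by rewrite yq eqr_opp eq_sym.
Qed.

Lemma closed_closed_cell s q : closed (closed_cell s q).
Proof.
rewrite (_ : closed_cell s q = S `&` \bigcap_(x in [set` s]) [set y | 0 <= dotv x q * dotv x y]).
  apply: closedI; first exact: closed_sphere.
  apply: closed_bigI => x _.
  rewrite (_ : mkset _ = [set y | 0 <= dotv y (dotv x q *: x)]).
    by apply: closed_ge_fun; [exact: cst_continuous|exact: continuous_dotv].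
  by apply/seteqP; split => y /=; rewrite dotvZr (dotvC y).
by [].
Qed.

(** A point of the closed cell, moved slightly towards [q], enters the open cell. *)
Lemma closure_open_cell s q : S q -> off_hyperspheres s q ->
  closure (open_cell s q) = closed_cell s q.
Proof.
move=> Sq nq; apply/seteqP; split.
  rewrite [X in _ `<=` X](closure_id _).1; last exact: closed_closed_cell.
  by apply: closureS => y [Sy ys]; split => // x /ys/ltW.
move=> y cy B yB; have Sy : S y by case: cy.
have [t [t0 t1 w0 Bt]] := sphere_line_near (q - y) Sy yB.
by exists (normalize (y + t *: (q - y))); split => //; apply: open_cell_line => //; exact: ltW.
Qed.

Lemma open_cell_nbhs s p : off_hyperspheres s p ->
  nbhs p [set y | forall x, x \in s -> 0 < dotv x p * dotv x y].
Proof.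
elim: s => [|x s IHs] np; first exact: (filterS _ filterT).
have := IHs (fun y ys => np y (mem_behead (s := x :: s) ys)).
have : nbhs p [set y | 0 < dotv x p * dotv x y].
  apply: open_nbhs_nbhs; split; last first.
    by rewrite /= -expr2 exprn_even_gt0//= np// mem_head.
  rewrite (_ : mkset _ = ~` [set y | dotv y (dotv x p *: x) <= 0]).
    apply: closed_openC; apply: closed_ge_fun; last exact: cst_continuous.
    exact: continuous_dotv.
  by apply/seteqP; split => y /=; rewrite dotvZr (dotvC y) ltNge => /negP.
apply: filterS2 => y y1 ys z; rewrite inE => /predU1P[->//|]; exact: ys.
Qed.

(** Ensures that the sphere is connected, so that it is the only cell of an empty list;
    [sphere_avoid] provides it. *)
Hypothesis avoid : forall q, exists2 e, S e & e != q /\ e != - q.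

Lemma cellsP s Z : cells s Z <->
  exists q, [/\ S q, off_hyperspheres s q & Z = closed_cell s q].
Proof.
split=> [[q /off_hyperspheresP[Sq nq] <-]|[q [Sq nq ->]]]; have [e' Se' [eq eNq]] := avoid q.
  exists q; split => //.
  by rewrite (connected_component_open_cell Se' eq eNq Sq nq) closure_open_cell.
exists q; first exact/off_hyperspheresP.
by rewrite (connected_component_open_cell Se' eq eNq Sq nq) closure_open_cell.
Qed.

(** If the cell of [q] contains [p], then [p] and [q] lie strictly on the same side of every
    hypersphere, so both define the same closed cell. *)
Lemma crofton_cellE s p : S p -> off_hyperspheres s p -> crofton_cell p s = closed_cell s p.
Proof.
move=> Sp np; have pp : within S (nbhs p) (closed_cell s p).
  rewrite /within/=; apply: filterS (open_cell_nbhs np) => y ys Sy.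
  by split => // x /ys/ltW.
apply: xget_subset1; first by split => //; apply/cellsP; exists p.
suff H Z : cells s Z /\ within S (nbhs p) Z -> Z = closed_cell s p.
  by move=> Z Z' /H -> /H ->.
move=> [/cellsP[q [Sq nq ->]] /nbhs_singleton /(_ Sp)[_ qp]].
have {}qp x : x \in s -> 0 < dotv x q * dotv x p.
  by move=> xs; rewrite lt_neqAle qp// andbT eq_sym mulf_neq0 ?nq ?np.
apply/seteqP; split => y [Sy ys]; split => // x xs; have := ys x xs; have := qp x xs.
  have [x0|x0] := ltP 0 (dotv x q).
    by rewrite pmulr_rgt0// pmulr_rge0// => ? ?; rewrite mulr_ge0// ltW.
  have {}x0 : dotv x q < 0 by rewrite lt_neqAle nq.
  by rewrite nmulr_rgt0// nmulr_rge0// => ? ?; rewrite mulr_le0// ltW.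
have [x0|x0] := ltP 0 (dotv x q).
  by rewrite pmulr_rgt0// => ?; rewrite pmulr_rge0// => ?; rewrite mulr_ge0// ltW.
have {}x0 : dotv x q < 0 by rewrite lt_neqAle nq.
by rewrite nmulr_rgt0// => ?; rewrite nmulr_rge0// => ?; rewrite mulr_le0// ltW.
Qed.

(** If [p] lies on the hypersphere of [x], a small displacement along [- dotv x q *: x] leaves the
    cell of [q]; no cell has [p] in its interior and the default is taken. *)
Lemma crofton_cell_set0 s p : (forall x, x \in s -> S x) -> S p ->
  ~ off_hyperspheres s p -> crofton_cell p s = set0.
Proof.
move=> sS Sp np; apply: xgetPN => Z [/cellsP[q [Sq nq ->]] pZ]; apply: np => x xs.
apply/eqP => xp; have [t [t0 t1 w0 Zt]] := sphere_line_near (- dotv x q *: x) Sp pZ.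
have /sphereE x1 := sS x xs.
have [_ /(_ x xs)] := Zt (sphere_normalize w0).
rewrite dotv_normalize dotvDr xp add0r !dotvZr x1 mulr1 leNgt => /negP; apply.
rewrite !mulrN mulrCA oppr_lt0 mulr_gt0 ?invr_gt0 ?enorm_gt0//.
by rewrite mulrCA mulr_gt0// -expr2 exprn_even_gt0//= nq.
Qed.

(** The cone contains [p] but, as soon as there is one pole, not [- p]; hence it is not a
    subspace. *)
Lemma closed_cell_convex_bodies s p : S p -> s != [::] -> off_hyperspheres s p ->
  convex_bodies (closed_cell s p).
Proof.
move=> Sp s0 np; exists [set y | forall x, x \in s -> 0 <= dotv x p * dotv x y]; split.
- split; last 2 first.
  + by move=> x _; rewrite dotv0r mulr0.
  + move=> a b x y a0 b0 xs ys z zs; rewrite dotvDr !dotvZr mulrDr.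
    by rewrite !(mulrCA (dotv z p)) addr_ge0// mulr_ge0 ?xs ?ys.
  + rewrite (_ : mkset _ = \bigcap_(x in [set` s]) [set y | 0 <= dotv y (dotv x p *: x)]).
      apply: closed_bigI => x _.
      by apply: closed_ge_fun; [exact: cst_continuous|exact: continuous_dotv].
    by apply/seteqP; split => y ys x xs; have := ys x xs; rewrite /= dotvZr (dotvC y).
- move=> [_ /(_ (-1) 0 p p)]; case: s s0 np => // x s _ np.
  have pC y : y \in x :: s -> 0 <= dotv y p * dotv y p by move=> _; rewrite -expr2 sqr_ge0.
  move=> /(_ pC pC x (mem_head _ _)); rewrite scale0r addr0 dotvZr mulrCA mulN1r oppr_ge0.
  by rewrite leNgt -expr2 exprn_even_gt0//= np// mem_head.
- by [].
Qed.

End crofton_cells.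

(** * Closeness of bodies *)

Section hausdorff_near.
Context {R : realType} {d : nat}.
Local Notation V := 'rV[R]_d.+1.
Local Notation S := (@sphere R d).
Implicit Types (x y z p q : V) (K L : set V) (F : set (set V)).

(** Compares the sup norm with the angle through the identity of [sphere_dotvB]. Cutting [e] off at
    1 keeps [t] in the interval from 0 to [pi], where the cosine decreases. *)
Lemma geodist_small (e : R) : 0 < e -> exists2 r : R, 0 < r &
  forall x y, S x -> S y -> `|x - y| <= r -> geodist x y <= e.
Proof.
move=> e0; pose t := Num.min e 1.
have t0 : 0 < t by rewrite lt_min e0 ltr01.
have t1 : t <= 1 by rewrite ge_min lexx orbT.
have tpi : t \in `[0, pi]%R.
  by rewrite in_itv/= ltW//= (le_trans t1)// (le_trans _ (pi_ge2 R))// ler1n.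
have ct : cos t < 1.
  by rewrite -cos0 ltr_cos// in_itv/= lexx pi_ge0.
pose r := Num.min 1 ((1 - cos t) / d.+1%:R).
have r0 : 0 < r by rewrite lt_min ltr01 divr_gt0// subr_gt0.
have r1 : r <= 1 by rewrite ge_min lexx.
exists r => // x y Sx Sy xy; rewrite /geodist.
apply: (@le_trans _ _ t); last by rewrite ge_min lexx.
have xyI := sphere_dotv_itv Sx Sy.
rewrite leNgt; apply/negP => tac.
have : cos (acos (dotv x y)) < cos t.
  by rewrite ltr_cos// in_itv/= acos_ge0// acos_lepi.
rewrite acosK ?in_itv// => xyt.
have : dotv (x - y) (x - y) <= 1 - cos t.
  apply: le_trans (ler_norm _) _; apply: le_trans (ler_dotv_norm _ _) _.
  rewrite mulrC -ler_pdivlMr//; apply: (@le_trans _ _ r); last by rewrite ge_min lexx orbT.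
  by rewrite -[leRHS]mulr1 ler_pM// (le_trans xy).
have := dotv_ge0 (x - y); move: xyt; rewrite sphere_dotvB//; lra.
Qed.

(** Hausdorff closeness in the sup norm, meaningful also when [K] is a finite set of sample
    points. *)
Definition near_sets (r : R) K L :=
  (forall x, K x -> exists2 y, L y & `|x - y| <= r) /\
  (forall y, L y -> exists2 x, K x & `|x - y| <= r).

Lemma sup_inf_le (T1 T2 : Type) (A : set T1) (B : set T2) (f : T1 -> T2 -> R) (e : R) :
  A !=set0 -> (forall u v, A u -> B v -> 0 <= f u v) ->
  (forall u, A u -> exists2 v, B v & f u v <= e) ->
  sup [set inf [set f u v | v in B] | u in A] <= e.
Proof.
move=> [x Ax] f0 AB; apply: sup_le_ub; first by exists (inf [set f x v | v in B]), x.
move=> _ [z Az <-]; have [y By zy] := AB z Az.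
apply: le_trans zy; apply: ge_inf; last by exists y.
by exists 0 => _ [w Bw <-]; exact: f0.
Qed.

Lemma hausdorff_near (e : R) : 0 < e -> exists2 r : R, 0 < r &
  forall K L, K !=set0 -> L !=set0 -> K `<=` S -> L `<=` S ->
    near_sets r K L -> hausdorff K L < e.
Proof.
move=> e0; have e2 : 0 < e / 2 by rewrite divr_gt0.
have [r r0 rP] := geodist_small e2.
exists r => // K L K0 L0 KS LS [KL LK].
apply: (@le_lt_trans _ _ (e / 2)); last by rewrite ltr_pdivrMr// ltr_pMr// ltr1n.
have g0 x y : S x -> S y -> 0 <= geodist x y.
  by move=> Sx Sy; rewrite acos_ge0// sphere_dotv_itv.
rewrite /hausdorff ge_max; apply/andP; split; apply: sup_inf_le => //.
- by move=> x y /KS Sx /LS Sy; exact: g0.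
- by move=> x Kx; have [y Ly xy] := KL x Kx; exists y => //; apply: rP; auto.
- by move=> y x /LS Sy /KS Sx; exact: g0.
- by move=> y Ly; have [x Kx xy] := LK y Ly; exists x => //; apply: rP; auto.
Qed.

Definition near_closed F := F `<=` @convex_bodies R d /\
  forall K, convex_bodies K ->
    (forall r : R, 0 < r -> exists2 L, F L & near_sets r K L) -> F K.

Lemma near_hausdorff K (F : set (set V)) (r : R) : 0 < r -> convex_bodies K ->
  F `<=` @convex_bodies R d ->
  (forall r : R, 0 < r -> exists2 L, F L & near_sets r K L) ->
  exists2 L, F L & hausdorff K L < r.
Proof.
move=> r0 bK Fb near; have [s s0 sP] := hausdorff_near r0.
have [L FL KL] := near s s0; exists L => //.
by apply: sP => //; [exact: convex_bodies_nonempty|apply/convex_bodies_nonempty/Fb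
  |exact: convex_bodies_sphere|apply/convex_bodies_sphere/Fb].
Qed.

Lemma near_closed_superlevel (Sigma : set V -> R) (a : R) :
  hausdorff_continuous (@convex_bodies R d) Sigma -> near_closed (superlevel Sigma a).
Proof.
move=> cS; have Fb : superlevel Sigma a `<=` @convex_bodies R d by move=> L [].
split=> // K bK near; split=> //; rewrite leNgt; apply/negP => Ka.
have [r r0 rP] := cS K bK (a - Sigma K) ltac:(by rewrite subr_gt0).
have [L [bL La] KL] := near_hausdorff r0 bK Fb near.
have := rP L bL KL; rewrite ltr_norml => /andP[_]; lra.
Qed.

(** Since [theta] is continuous on the superlevel set only, the limit body is first shown to belong
    to that set. *)
Lemma near_closed_superlevel_theta (Sigma theta : set V -> R) (a e : R) :
  hausdorff_continuous (@convex_bodies R d) Sigma ->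
  hausdorff_continuous (superlevel Sigma a) theta ->
  near_closed [set K | superlevel Sigma a K /\ e <= theta K].
Proof.
move=> cS ct; set F := [set K | _].
have Fb : F `<=` @convex_bodies R d by move=> L [[]].
split=> // K bK near.
have sK : superlevel Sigma a K.
  have [_] := near_closed_superlevel a cS; apply => // r r0.
  by have [L [sL _] KL] := near r r0; exists L.
split=> //; rewrite leNgt; apply/negP => Ke.
have [r r0 rP] := ct K sK (e - theta K) ltac:(by rewrite subr_gt0).
have [L [sL Le] KL] := near_hausdorff r0 bK Fb near.
have := rP L sL KL; rewrite ltr_norml => /andP[_]; lra.
Qed.

(** A cone containing the sphere is the whole space, a linear subspace. *)
Lemma sphere_not_convex_body : ~ convex_bodies S.
Proof.
move=> [C [CC nC SC]]; apply: nC.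
suff CT x : C x by split.
have [->|x0] := eqVneq x 0; first by case: CC.
have : S (normalize x) by exact: sphere_normalize.
rewrite SC => -[_ Cx]; rewrite (normalizeE x); apply: cone_scale => //.
exact: enorm_ge0.
Qed.

End hausdorff_near.

Lemma sphere_avoid (R : realType) d (q : 'rV[R]_d.+2) :
  exists2 e, sphere e & e != q /\ e != - q.
Proof.
pose e0 : 'rV[R]_d.+2 := row_cons 1 0.
pose e1 : 'rV[R]_d.+2 := row_cons 0 (row_cons 1 0).
have S0 : sphere e0 by apply/sphereE; rewrite dotv_row_cons dotv0r; ring.
have S1 : sphere e1 by apply/sphereE; rewrite !dotv_row_cons dotv0r; ring.
have e01 : dotv e0 e1 = 0 by rewrite dotv_row_cons dotvC dotv0r; ring.
have ne (b : bool) : e1 != (-1) ^+ b *: e0.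
  apply/eqP => e10; move/sphereE: S1; rewrite {1}e10 dotvZl e01 mulr0 => /esym/eqP.
  by rewrite oner_eq0.
have e10 : e1 != e0 by have := ne false; rewrite scale1r.
have e1N0 : e1 != - e0 by have := ne true; rewrite expr1 scaleN1r.
have [->|q0] := eqVneq q e0; first by exists e1.
have [->|q1] := eqVneq q (- e0); first by exists e1 => //; rewrite opprK.
exists e0 => //; split; first by rewrite eq_sym.
by apply: contra_neq q1 => ->; rewrite opprK.
Qed.

(** * The Crofton cell of a Poisson process *)

Section poisson_cell.
Context {R : realType} {d : nat} {dO : measure_display}
  {Omega : measurableType dO} {P : probability Omega R}.
Local Notation V := 'rV[R]_d.+1.
Local Notation S := (@sphere R d).
Local Notation sigma := (@sphere_measure R d).
Variables (gamma : R) (X : Omega -> seq V) (p : V).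
Hypotheses (gamma0 : 0 < gamma) (PX : isotropic_poisson_process P gamma X) (Sp : S p).
Hypothesis avoid : forall q : V, exists2 e, S e & e != q /\ e != - q.
Local Notation Z0 := (fun w => crofton_cell p (X w)).

Definition no_point (A : set V) : set Omega := [set w | forall x, x \in X w -> ~ A x].

Lemma no_pointE A : no_point A = npoints X A @^-1` [set 0%N].
Proof.
apply/seteqP; split => w /=.
  move=> nA; apply/eqP; rewrite eqn0Ngt -has_count; apply/hasPn => x /nA.
  by move=> Ax; apply/negP; rewrite /= inE.
move=> /eqP; rewrite eqn0Ngt -has_count => /hasPn nA x /nA.
by move=> /negP Ax Ax'; apply: Ax; rewrite /= inE.
Qed.

Lemma measurable_no_point (A : set (borel_rV R d.+1)) : measurable A ->
  measurable (no_point A).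
Proof.
move=> mA; rewrite no_pointE; have [_ /(_ A mA) mN _ _] := PX.
exact: measurable_preimage.
Qed.

Lemma probability_no_point (A : set (borel_rV R d.+1)) : measurable A ->
  P (no_point A) = (expR (- (gamma * fine (sigma A))))%:E.
Proof.
move=> mA; rewrite no_pointE; have [_ _ -> // _] := PX.
rewrite /poisson_prob; case: ifPn => [r0|].
  by rewrite esum_set1 ?lee_fin ?poisson_pmf_ge0// /poisson_pmf r0 expr0 fact0 invr1 !mul1r.
(* For a null set the rate is 0: the Dirac measure at 0 gives 1, in agreement with the
   exponential. *)
rewrite -leNgt pmulr_rle0// => s0.
have -> : fine (sigma A) = 0 by apply/eqP; rewrite eq_le s0 fine_ge0.
by rewrite mulr0 oppr0 expR0 diracE mem_set.
Qed.

Lemma points_sphere w x : x \in X w -> S x.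
Proof. by have [+ _ _ _] := PX; exact. Qed.

Definition hyperplane_of (q : V) : set (borel_rV R d.+1) := [set x | dotv x q = 0].

Lemma measurable_hyperplane_of q : measurable (hyperplane_of q).
Proof.
apply: closed_measurable_rV.
rewrite (_ : hyperplane_of q = [set x | dotv x q <= 0] `&` [set x | 0 <= dotv x q]).
  by apply: closedI; apply: closed_ge_fun; do ?[exact: cst_continuous|exact: continuous_dotv].
by apply/seteqP; split => x /=; [move=> ->|move=> [? ?]; apply/eqP; rewrite eq_le; apply/andP].
Qed.

Lemma off_hyperspheresE w : off_hyperspheres (X w) p <-> no_point (hyperplane_of p) w.
Proof.
split=> [H x /H/eqP//|H x xX]; apply/eqP; exact: H.
Qed.

Lemma no_point_sphereE w : X w = [::] <-> no_point S w.
Proof.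
split=> [Xw x|nS]; first by rewrite Xw.
by case E : (X w) => [//|x s]; have xX : x \in X w; rewrite ?E ?mem_head//;
  case: (nS x xX); exact: points_sphere xX.
Qed.

Lemma crofton_cell_body w : convex_bodies (Z0 w) <->
  off_hyperspheres (X w) p /\ X w != [::].
Proof.
split=> [bZ|[ow Xw]]; last by rewrite crofton_cellE//; exact: closed_cell_convex_bodies.
have ow : off_hyperspheres (X w) p.
  apply: contrapT => nw; move: bZ; rewrite crofton_cell_set0//; last exact: points_sphere.
  by move=> /convex_bodies_nonempty[].
split=> //; apply/eqP => Xw; move: bZ; rewrite crofton_cellE// Xw.
suff -> : closed_cell [::] p = S by exact: sphere_not_convex_body.
by apply/seteqP; split => y; [case|split].
Qed.

Lemma crofton_cell_sphere w : Z0 w = S <-> X w = [::].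
Proof.
split=> [ZS|Xw]; last first.
  by rewrite Xw crofton_cellE//; apply/seteqP; split => y; [case|split].
apply: contrapT => /eqP Xw.
have [ow|nw] := pselect (off_hyperspheres (X w) p).
  have : convex_bodies (Z0 w) by apply/crofton_cell_body.
  by rewrite ZS; exact: sphere_not_convex_body.
move: ZS; rewrite crofton_cell_set0//; last exact: points_sphere.
by move=> /seteqP[_ /(_ p Sp)].
Qed.

(** A point of [K] on the other side of some hypersphere from [p] would, by [convex_bodies_zero],
    make that hypersphere hit [K]. *)
Lemma crofton_cell_contains w K : convex_bodies K -> K p ->
  no_point (hitting K) w -> K `<=` Z0 w.
Proof.
move=> bK Kp nw y Ky; have KS := convex_bodies_sphere bK.
have nz x z : x \in X w -> K z -> dotv x z != 0.
  move=> xX Kz; apply/eqP => xz; apply: (nw x xX); split; first exact: points_sphere xX.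
  by exists z; split => //; split => //; exact: KS.
rewrite crofton_cellE//; last by move=> x xX; exact: nz.
split; first exact: KS.
move=> x xX; rewrite leNgt; apply/negP => py.
have [z Kz xz] : exists2 z, K z & dotv x z = 0.
  have [p0|p0] := leP 0 (dotv x p).
    apply: (convex_bodies_zero bK Kp Ky p0).
    have {}p0 : 0 < dotv x p by rewrite lt_neqAle eq_sym nz.
    by move: py; rewrite pmulr_rlt0// => /ltW.
  apply: (convex_bodies_zero bK Ky Kp _ (ltW p0)).
  by move: py; rewrite nmulr_rlt0// => /ltW.
by have /eqP := nz x z xX Kz.
Qed.

Lemma crofton_cell_separating w r s : convex_bodies (Z0 w) ->
  no_point (separating r (near_net r s (Z0 w))) w.
Proof.
move=> /crofton_cell_body[ow _]; rewrite crofton_cellE// => x xX.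
move=> /separating_near_net[y [z [[_ /(_ x xX) py] [_ /(_ x xX) pz] xy xz]]].
move: py pz; rewrite pmulr_lge0// nmulr_lge0// => p0 p1.
by have := ow x xX; rewrite eq_le p0 p1.
Qed.

Lemma sphere_dense : exists q : nat * nat -> V, (forall c, S (q c)) /\
  forall y (r : R), S y -> 0 < r -> exists c, `|y - q c| < r.
Proof.
have /choice[net netP] : forall j : nat, exists s : seq V, (forall g, g \in s -> S g) /\
    forall y, S y -> exists2 g, g \in s & `|y - g| < j.+1%:R^-1.
  by move=> j; apply: sphere_net; rewrite invr_gt0.
(* The pair gives a mesh and a position in the net of that mesh; the default [p] keeps the
   out-of-range values on the sphere. *)
exists (fun c => nth p (net c.1) c.2); split.
  move=> [j i] /=; have [ij|ij] := ltnP i (size (net j)); last by rewrite nth_default.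
  by have [netS _] := netP j; apply/netS/mem_nth.
move=> y r Sy r0; have [j jr] : exists j : nat, j.+1%:R^-1 < r.
  exists (Num.truncn r^-1); rewrite invf_plt ?posrE//.
  have : 0 <= r^-1 by rewrite invr_ge0 ltW.
  by move=> /truncn_itv/andP[_].
have [_ /(_ y Sy)[g gs yg]] := netP j.
by exists (j, index g (net j)); rewrite nth_index//; exact: lt_trans jr.
Qed.

(** The open cell is dense in the closed one and relatively open, so the dense sequence enters it
    near every point of the closed cell. *)
Lemma open_cell_near w (q : nat * nat -> V) y (r : R) :
  (forall c, S (q c)) -> (forall y (r : R), S y -> 0 < r -> exists c, `|y - q c| < r) ->
  off_hyperspheres (X w) p -> closed_cell (X w) p y -> 0 < r ->
  exists2 c, open_cell (X w) p (q c) & `|y - q c| < r.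
Proof.
move=> Sq dq ow cy r0.
have : closure (open_cell (X w) p) y by rewrite closure_open_cell.
move=> /(_ (ball y (r / 2)))[|z [[Sz pz]]]; first by apply: nbhsx_ballx; rewrite divr_gt0.
rewrite -ball_normE/= => yz.
have oz : off_hyperspheres (X w) z.
  by move=> x /pz; rewrite lt_neqAle eq_sym mulf_eq0 negb_or => /andP[/andP[]].
have /nbhs_ballP[e /= e0 eP] := open_cell_nbhs oz.
have [|c] := dq z (Num.min e (r / 2)) Sz; first by rewrite lt_min e0 divr_gt0.
rewrite lt_min => /andP[ze zr]; exists c.
  split; first exact: Sq.
  move=> x xX; have := eP (q c); rewrite -ball_normE/= => /(_ ze x xX) zc.
  have := mulr_gt0 (pz x xX) zc.
  have -> : dotv x p * dotv x z * (dotv x z * dotv x (q c)) =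
      dotv x z ^+ 2 * (dotv x p * dotv x (q c)) by ring.
  by rewrite pmulr_rgt0// exprn_even_gt0//= oz.
by rewrite -(subrKA z) (le_lt_trans (ler_normD _ _))// [ltRHS](splitr r) ltrD.
Qed.

(** For every mesh there must be a finite list [E] of sample points in the open cell that
    approximates the sample points there and is near a member of [F]. There are countably many
    lists, and each condition is a countable combination of events that no pole falls in a given
    set. *)
Lemma measurable_crofton_cell (F : set (set V)) : near_closed F ->
  measurable [set w | F (Z0 w)].
Proof.
move=> [Fb Fcl]; have [q [Sq dq]] := sphere_dense.
pose W (c : nat * nat) := no_point [set x : borel_rV R d.+1 | dotv x p * dotv x (q c) <= 0].
have mW c : measurable (W c).
  apply: measurable_no_point.
  rewrite (_ : mkset _ = setT `&` (fun x : borel_rV R d.+1 => dotv (x : V) p * dotv (x : V) (q c)) @^-1` `]-oo, 0]); last first.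
    by rewrite setTI; apply/seteqP; split => x; rewrite /= in_itv.
  suff mf : measurable_fun setT (fun x : borel_rV R d.+1 => dotv (x : V) p * dotv (x : V) (q c)).
    exact: mf.
  by apply: measurable_funM; exact: measurable_dotv.
have WE w c : W c w <-> open_cell (X w) p (q c).
  split=> [Wc|[_ Wc] x /Wc /=]; last by rewrite ltNge => /negP.
  by split=> // x /Wc /= /negP; rewrite -ltNge.
pose r (j : nat) : R := j.+1%:R^-1.
pose close j (E : seq (nat * nat)) c := exists2 e, e \in E & `|q c - q e| <= r j.
pose approx j (E : seq (nat * nat)) :=
  exists2 L, F L & near_sets (r j) [set q e | e in [set` E]] L.
(* Whether [approx] holds depends on [j] and [E] alone and not on the outcome, so it only selects
   which lists contribute. *)
pose ev j (E : seq (nat * nat)) : set Omega := if `[< approx j E >] then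
  (\bigcap_(e in [set` E]) W e) `&`
  (\bigcap_(c in [set: nat * nat]) (if `[< close j E c >] then setT else ~` W c)) else set0.
have mev j E : measurable (ev j E).
  rewrite /ev; case: ifP => // _; apply: measurableI.
    by apply: fin_bigcap_measurable => // e _; exact: mW.
  rewrite (_ : bigcap _ _ = ~` \bigcup_c (if `[< close j E c >] then set0 else W c)).
    apply: measurableC; apply: countable_bigcupT_measurable => // c.
    by case: ifP.
  rewrite setC_bigcup; apply: eq_bigcapr => c _.
  by case: ifP => _; rewrite ?setC0.
rewrite (_ : mkset _ = (no_point (hyperplane_of p) `\` no_point S) `&`
    \bigcap_j \bigcup_E ev j E).
  apply: measurableI.
    apply: measurableD; apply: measurable_no_point.
      exact: measurable_hyperplane_of.
    exact: measurable_sphere.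
  by apply: bigcapT_measurable => j; apply: countable_bigcupT_measurable.
apply/seteqP; split=> w /=.
  move=> FZ; have /Fb bZ := FZ.
  have [ow Xw] := (crofton_cell_body w).1 bZ.
  split; first by split; [exact/off_hyperspheresE|move=> /no_point_sphereE/eqP; rewrite (negbTE Xw)].
  move: bZ FZ; rewrite crofton_cellE// => bZ FZ.
  have sub c : W c w -> closed_cell (X w) p (q c).
    by move=> /WE[Sc pc]; split => // x /pc/ltW.
  move=> j _; have rj : 0 < r j by rewrite invr_gt0.
  (* Compactness of the cell extracts the finite list from the balls around the sample points in the
     open cell. *)
  have := convex_bodies_compact bZ; rewrite compact_cover.
  move=> /(_ _ [set c | W c w] (fun c => ball (q c) (r j)))[].
  - by move=> c _; exact: ball_open.
  - move=> y cy; have [c cc yc] := open_cell_near Sq dq ow cy rj.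
    by exists c; [exact/WE|rewrite -ball_normE/= distrC].
  - move=> D DW cD; exists (finmap.enum_fset D) => //.
    have nearD y : closed_cell (X w) p y ->
        exists2 e, e \in finmap.enum_fset D & `|y - q e| <= r j.
      by move=> /cD[e /= De]; rewrite -ball_normE/= distrC => /ltW ye; exists e.
    have DW' e : e \in finmap.enum_fset D -> W e w by move=> /DW; rewrite inE.
    rewrite /ev ifT.
      split; first by move=> e /DW'.
      move=> c _; case: ifPn => // /asboolP nc Wc; apply: nc.
      by have [e De ce] := nearD _ (sub c Wc); exists e.
    apply/asboolP; exists (closed_cell (X w) p) => //; split.
      move=> _ [e /= /DW'/sub ce <-]; exists (q e) => //.
      by rewrite subrr normr0 ltW.
    move=> y /nearD[e De ye]; exists (q e); first by exists e.
    by rewrite distrC.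
move=> [[/off_hyperspheresE ow nX] H].
have Xw : X w != [::] by apply/eqP => /no_point_sphereE.
have bZ : convex_bodies (Z0 w) by apply/crofton_cell_body.
apply: Fcl => // e e0; move: bZ; rewrite crofton_cellE// => bZ.
(* The three steps lead from the cell to a sample point, from there to a point of [E], and from that
   to [L]. *)
have [j je] : exists j : nat, 3 * r j <= e.
  exists (Num.truncn (3 / e)); rewrite /r ler_pdivrMr// mulrC -ler_pdivrMr//.
  have : 0 <= 3 / e by rewrite divr_ge0// ltW.
  by move=> /truncn_itv/andP[_ /ltW].
have rj : 0 < r j by rewrite invr_gt0.
have [E _] := H j I; rewrite /ev; case: ifPn => // /asboolP[L FL [EL LE]] [EW nearE].
exists L => //.
have nearZ y : closed_cell (X w) p y -> exists2 e, e \in E & `|y - q e| <= 2 * r j.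
  move=> cy; have [c cc yc] := open_cell_near Sq dq ow cy rj.
  have := nearE c I; case: ifPn => [/asboolP[f Ef cf] _|_ nW]; last by case: nW; exact/WE.
  exists f => //; rewrite -(subrKA (q c)) (le_trans (ler_normD _ _))//.
  by rewrite mulr_natl mulr2n lerD// ltW.
split=> [y /nearZ[f Ef yf]|y Ly].
  have [z Lz fz] := EL (q f) (ex_intro2 _ _ f Ef erefl).
  exists z => //; apply: le_trans je; rewrite -(subrKA (q f)) (le_trans (ler_normD _ _))//.
  by rewrite (_ : 3 * r j = 2 * r j + r j) ?lerD//; ring.
have [_ [f Ef <-] yf] := LE y Ly; exists (q f).
  by have /WE[Sf pf] := EW f Ef; split => // x /pf/ltW.
by apply: le_trans yf _; apply: le_trans je; rewrite ler_pMl// ler1n.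
Qed.

End poisson_cell.

(** * The deviation estimate *)

Section crofton_probability.
Context {R : realType} {d : nat} {dO : measure_display}
  {Omega : measurableType dO} {P : probability Omega R}.
Local Notation V := 'rV[R]_d.+2.
Local Notation S := (@sphere R d.+1).
Variables (gamma : R) (X : Omega -> seq V) (p : V).
Hypotheses (gamma0 : 0 < gamma) (PX : isotropic_poisson_process P gamma X) (Sp : S p).
Local Notation Z0 := (fun w => crofton_cell p (X w)).
Local Notation avoid := (@sphere_avoid R d).
Local Notation sigma := (@sphere_measure R d.+1).
Variables (Sigma : set V -> R) (a : R).
Hypotheses (hSigma : size_functional Sigma) (hSphere : sphere_extension Sigma)
  (hIncr : increasing_functional Sigma) (hRot : rotation_invariant Sigma).

(** With no pole the cell is the whole sphere, whose extended size is at least that of [K], hence at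
    least [a]. *)
Lemma size_eventE K : superlevel Sigma a K ->
  size_event Sigma a Z0 = no_point X S `|` [set w | superlevel Sigma a (Z0 w)].
Proof.
move=> [bK aK]; apply/seteqP; split => w /=.
  move=> [[bZ|ZS] aZ]; first by right.
  by left; apply/(no_point_sphereE PX)/(crofton_cell_sphere PX Sp avoid).
move=> [/(no_point_sphereE PX)/(crofton_cell_sphere PX Sp avoid) ZS|[bZ aZ]]; last by split => //; left.
by split; [right|rewrite ZS (le_trans aK)// hSphere].
Qed.

Lemma measurable_size_event K : superlevel Sigma a K ->
  measurable (size_event Sigma a Z0).
Proof.
move=> sK; rewrite (size_eventE sK); apply: measurableU.
  by apply: (measurable_no_point PX); exact: measurable_sphere.
apply: (measurable_crofton_cell PX Sp avoid); apply: near_closed_superlevel.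
by case: hSigma.
Qed.

Lemma probability_size_event_ge K : superlevel Sigma a K ->
  expR (- (gamma * Phi2U1 K)) <= fine (P (size_event Sigma a Z0)).
Proof.
move=> sK; have [bK aK] := sK; have mS := measurable_size_event sK.
have [y Ky] := convex_bodies_nonempty bK.
have [M pM yM] := sphere_rotates (convex_bodies_sphere bK Ky) Sp.
have [rM _] := pM; have bM := convex_bodies_rotation bK rM.
have Mp : [set x *m M | x in K] p by exists y.
rewrite -(Phi2U1_rotation bK bM pM) Phi2U1E//.
rewrite -lee_fin fineK ?fin_num_measure// -(probability_no_point gamma0 PX); last exact: measurable_hitting.
apply: le_measure; rewrite ?inE//.
  by apply: (measurable_no_point PX); exact: measurable_hitting.
move=> w nw; have KZ := crofton_cell_contains PX Sp avoid bM Mp nw.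
have [/eqP Xw|Xw] := boolP (X w == [::]).
  by rewrite (size_eventE sK); left; apply/(no_point_sphereE PX).
have bZ : convex_bodies (Z0 w).
  apply/(crofton_cell_body PX Sp avoid); split => // x xX; apply/eqP => xp.
  by apply: (nw x xX); split; [exact: (points_sphere PX xX)|exists p].
split; first by left.
by apply: le_trans (hIncr bM bZ KZ); rewrite hRot.
Qed.

(** The logarithm turns the bounds for the single bodies into one lower bound of all values of
    [Phi2U1], which passes to their infimum. *)
Lemma probability_size_event_ge_tau : superlevel Sigma a !=set0 ->
  expR (- (gamma * tau (@Phi2U1 R d.+1) Sigma a)) <= fine (P (size_event Sigma a Z0)).
Proof.
move=> [K0 sK0]; set pr := fine _.
have pr0 : 0 < pr by apply: lt_le_trans (probability_size_event_ge sK0); exact: expR_gt0.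
rewrite -[leRHS]lnK ?posrE// ler_expR lerNl -ler_pdivrMl//.
apply: lb_le_inf; first by exists (Phi2U1 K0), K0.
move=> _ [K sK <-]; rewrite ler_pdivrMl// lerNl -ler_expR lnK ?posrE//.
exact: probability_size_event_ge.
Qed.

Variables (theta : set V -> R) (e : R).
Hypothesis htheta : hausdorff_continuous (superlevel Sigma a) theta.

Lemma deviation_event_sub : deviation_event Sigma theta a e Z0 `<=` size_event Sigma a Z0.
Proof. by move=> w [[bZ aZ] _]; split => //; left. Qed.

Lemma measurable_deviation_event : measurable (deviation_event Sigma theta a e Z0).
Proof.
apply: (measurable_crofton_cell PX Sp avoid (F := [set K | superlevel Sigma a K /\ e <= theta K])).
by apply: near_closed_superlevel_theta => //; case: hSigma.
Qed.

(** Union bound over the masks of [s]: on the deviation event no pole falls in the separating set of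
    the record of the cell. *)
Lemma probability_deviation_event_le (r m' : R) (s : seq V) :
  (forall K, superlevel Sigma a K -> e <= theta K ->
     m' <= fine (sigma (separating r (near_net r s K)))) ->
  fine (P (deviation_event Sigma theta a e Z0)) <=
    #|{: (size s).-tuple bool}|%:R * expR (- (gamma * m')).
Proof.
move=> sep; rewrite -lee_fin fineK ?fin_num_measure//; last exact: measurable_deviation_event.
pose A (m : (size s).-tuple bool) := no_point X (separating r (mask m s)).
(* Only masks with a separating set of measure at least [m'] occur on the deviation event, by
   [sep]. *)
pose ms := [seq m : (size s).-tuple bool <- enum {: (size s).-tuple bool} |
  m' <= fine (sigma (separating r (mask m s)))].
apply: (@le_trans _ _ ((size ms)%:R * expR (- (gamma * m')))%:E); last first.
  rewrite lee_fin ler_wpM2r ?expR_ge0// ler_nat cardE size_filter; exact: count_size.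
apply: (@measure_cover_le _ _ _ _ _ _ A).
- exact: measurable_deviation_event.
- by move=> m _; apply: (measurable_no_point PX); exact: measurable_separating.
- move=> w [sZ eZ]; have := sep _ sZ eZ; set G := near_net _ _ _ => mG.
  have sz : size [seq `[< exists2 y, Z0 w y & `|y - g| < r >] | g <- s] == size s by rewrite size_map.
  have GE : mask (Tuple sz) s = G by rewrite /G /near_net filter_mask.
  exists (Tuple sz); first by rewrite mem_filter mem_enum andbT GE.
  by rewrite /A GE; apply: (crofton_cell_separating PX Sp avoid); case: sZ.
- move=> m; rewrite mem_filter => /andP[mm _].
  have mT := @measurable_separating R d.+1 r (mask m s).
  have PT := probability_no_point gamma0 PX mT.
  by rewrite [leLHS]PT lee_fin ler_expR lerN2 ler_pM2l.
Qed.

End crofton_probability.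

Theorem theorem6p3 (R : realType) (d : nat) (hd : (2 <= d)%N)
    (Sigma : set 'rV[R]_d.+1 -> R)
    (hSigma : size_functional Sigma)
    (hSphere : sphere_extension Sigma)
    (hIncr : increasing_functional Sigma)
    (hRot : rotation_invariant Sigma)
    (a : R) (ha : 0 < a) (hne : superlevel Sigma a !=set0)
    (theta : set 'rV[R]_d.+1 -> R)
    (htheta : deviation_functional (@Phi2U1 R d) Sigma a theta)
    (eps : R) (heps : 0 < eps <= 1)
    (kappa : R) (hkappa : 0 < kappa < 1) :
  exists2 c3 : R, 0 < c3 &
    forall (f : R -> R),
      stability_function (@Phi2U1 R d) Sigma a theta f ->
    forall (p : 'rV[R]_d.+1), sphere p ->
    forall (gamma : R), 0 < gamma ->
    forall (dO : measure_display) (Omega : measurableType dO)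
      (P : probability Omega R) (X : Omega -> seq 'rV[R]_d.+1),
      isotropic_poisson_process P gamma X ->
    let Z0 := fun w => crofton_cell p (X w) in
    cond_prob P (deviation_event Sigma theta a eps Z0) (size_event Sigma a Z0)
      <= c3 * expR (- (kappa * gamma * f eps * tau (@Phi2U1 R d) Sigma a)).
Proof.
case: d hd Sigma hSigma hSphere hIncr hRot hne theta htheta => [//|d] _.
move=> Sigma hSigma hSphere hIncr hRot hne theta [ctheta theta0 _].
have /andP[eps0 _] := heps; have /andP[kappa0 kappa1] := hkappa.
set t := tau _ _ _.
have t0 : 0 <= t.
  have [K sK] := hne; apply: lb_le_inf; first by exists (Phi2U1 K), K.
  by move=> _ [L [bL _] <-]; exact: Phi2U1_ge0.
pose D := [set K | superlevel Sigma a K /\ eps <= theta K].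
pose m := inf [set Phi2U1 K | K in D].
(* A stability function forces [t < m]; without one any [c] will do. *)
have [c c0 cP] : exists2 c : R, 0 <= c & forall f,
    stability_function (@Phi2U1 R d.+1) Sigma a theta f -> t != 0 -> D !=set0 ->
    f eps * t <= m - t /\
    forall p, sphere p -> forall gamma, 0 < gamma ->
    forall (dO : measure_display) (Omega : measurableType dO)
      (P : probability Omega R) (X : Omega -> seq 'rV[R]_d.+2),
      isotropic_poisson_process P gamma X ->
      fine (P (deviation_event Sigma theta a eps (fun w => crofton_cell p (X w)))) <=
        c * expR (- (gamma * (t + kappa * (m - t)))).
  have fm f : stability_function (@Phi2U1 R d.+1) Sigma a theta f -> D !=set0 ->
      f eps * t <= m - t.
    move=> [_ _ _ _ fP] [K DK]; rewrite lerBrDr.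
    apply: lb_le_inf; first by exists (Phi2U1 K), K.
    move=> _ [L [sL eL] <-]; apply: le_trans (fP _ _ (ltW eps0) sL eL).
    by rewrite mulrDl mul1r addrC.
  have [[tm D0]|H] := pselect (t < m /\ D !=set0); last first.
    exists 0 => // f hf tn0 D0; exfalso; apply: H; split => //.
    rewrite -subr_gt0; apply: lt_le_trans (fm f hf D0).
    by case: hf => _ _ _ fpos _; rewrite mulr_gt0 ?fpos// lt_neqAle eq_sym tn0.
  have [C C0 CP] := @separating_measure_ge R d.+1.
  pose m' := t + kappa * (m - t).
  have m'm : 0 < m - m'.
    rewrite (_ : m - m' = (1 - kappa) * (m - t)); last by rewrite /m'; ring.
    by rewrite mulr_gt0 ?subr_gt0.
  (* The mesh makes the loss [C * r] at most [m - m']; adding 1 keeps the denominator positive. *)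
  pose r := (m - m') / (C + 1).
  have C1 : 0 < C + 1 by rewrite ltr_wpDl.
  have r0 : 0 < r by rewrite divr_gt0.
  have [s [_ sP]] := @sphere_net R d.+1 r r0.
  exists (#|{: (size s).-tuple bool}|%:R); first exact: ler0n.
  move=> f hf tn0 _; split; first exact: fm.
  move=> p Sp gamma gamma0 dO Omega P X PX.
  apply: (probability_deviation_event_le gamma0 PX Sp hSigma ctheta (r := r)).
  move=> K sK eK; have [bK _] := sK; apply: le_trans (CP r s K r0 sP bK).
  have mK : m <= Phi2U1 K.
    apply: ge_inf; last by exists K.
    by exists 0 => _ [L [[bL _] _] <-]; exact: Phi2U1_ge0.
  have Cr : C * r <= m - m'.
    rewrite /r mulrCA ler_piMr// ?(ltW m'm)// ler_pdivrMr// mul1r lerDl//.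
  by rewrite -/m'; lra.
(* The added 1 makes the constant positive and settles the case [t = 0], where the bound is a
   constant that must be at least 1. *)
exists (c + 1); first by rewrite ltr_wpDl.
move=> f hf p Sp gamma gamma0 dO Omega P X PX; set Z0 := (fun w => crofton_cell p (X w)).
cbv zeta; set dev := deviation_event _ _ _ _ _; set big := size_event _ _ _.
have [K sK] := hne.
have mbig : measurable big := measurable_size_event PX Sp hSigma hSphere sK.
have mdev : measurable dev := measurable_deviation_event PX Sp hSigma eps ctheta.
have db : dev `&` big = dev by apply/setIidPl; exact: deviation_event_sub.
have tb : expR (- (gamma * t)) <= fine (P big).
  exact: probability_size_event_ge_tau.
have b0 : 0 < fine (P big) by apply: lt_le_trans tb; exact: expR_gt0.
rewrite /cond_prob db ler_pdivrMr//.
have devbig : fine (P dev) <= fine (P big).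
  rewrite fine_le ?fin_num_measure//; apply: le_measure; rewrite ?inE//.
  exact: deviation_event_sub.
have [t00|tn0] := eqVneq t 0.
  rewrite t00 mulr0 oppr0 expR0 mulr1; apply: le_trans devbig _.
  by rewrite ler_peMl ?(ltW b0)// lerDr.
have [D0|D0] := pselect (D !=set0); last first.
  rewrite (_ : dev = set0) ?measure0.
    by rewrite mulr_ge0 ?(ltW b0)// mulr_ge0 ?expR_ge0// addr_ge0.
  by apply/seteqP; split => // w dw; apply: D0; exists (Z0 w).
have [ftm devP] := cP f hf tn0 D0.
apply: le_trans (devP _ Sp _ gamma0 _ _ _ _ PX) _.
rewrite -[leRHS]mulrA; apply: ler_pM; rewrite ?expR_ge0 ?lerDl//.
(* The exponent is split: [kappa * (m - t)] dominates [kappa * f eps * t], and the factor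
   [expR (- (gamma * t))] is absorbed by the lower bound [tb] for the conditioning event. *)
apply: (@le_trans _ _ (expR (- (kappa * gamma * f eps * t)) * expR (- (gamma * t)))).
  rewrite -expRD ler_expR.
  have : kappa * gamma * (f eps * t) <= kappa * gamma * (m - t).
    by rewrite ler_wpM2l// mulr_ge0// ltW.
  lra.
by rewrite ler_wpM2l ?expR_ge0.
Qed.
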